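(* Let $X$ be an infinite-dimensional complex Banach space and let $T$ be a bounded linear operator on $X$. Then $T$ is right generalized Drazin invertible if and only if $T$ admits a generalized Kato decomposition $(M,N)$ and the adjoint $T^*$ has the single-valued extension property at $0$.
   Context: $\mathcal{L}(X)$ is the algebra of bounded linear operators on $X$; $T_M$ denotes the restriction of $T$ to a $T$-invariant closed subspace $M$, regarded as an operator on $M$; $T^*$ is the adjoint acting on the dual space $X^*$. The quasinilpotent part of $T$ is $H_0(T)=\{x\in X:\lim_{n\to\infty}\|T^nx\|^{1/n}=0\}$. The analytical core $K(T)$ of $T$ is the set of all $x\in X$ for which there exist a sequence $(x_n)_{n\ge1}$ in $X$ and a constant $\delta>0$ such that $Tx_1=x$, $Tx_{n+1}=x_n$ and $\|x_n\|\le\delta^n\|x\|$ for all $n\in\mathbb{N}$. $T\in\mathcal{L}(X)$ is right generalized Drazin invertible if $K(T)$ is closed and there is a closed subspace $N$ of $X$ with $X=K(T)\oplus N$ and $T(N)\subset N\subseteq H_0(T)$. An operator $S$ is semi-regular if its range $R(S)$ is closed and $N(S^n)\subseteq R(S)$ for all $n\in\mathbb{N}$, where $N(\cdot)$ is the null space. A pair $(M,N)$ of closed subspaces is a generalized Kato decomposition (GKD) of $T$ if $X=M\oplus N$, $T(M)\subset M$, $T(N)\subset N$, $T_M$ is semi-regular and $T_N$ is quasinilpotent. An operator $S$ on a Banach space $Y$ has the single-valued extension property (SVEP) at $\lambda_0\in\mathbb{C}$ if for every connected open neighborhood $\mathcal{U}$ of $\lambda_0$ the only analytic function $f:\mathcal{U}\to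 Y$ satisfying $(\lambda I-S)f(\lambda)=0$ for all $\lambda\in\mathcal{U}$ is $f\equiv 0$. *)

(* Defs.v *)
From HB Require Import structures.
From mathcomp Require Import all_boot all_order all_algebra.
From mathcomp Require Import complex.
From mathcomp Require Import all_classical all_reals all_analysis.

Set Implicit Arguments.
Unset Strict Implicit.
Unset Printing Implicit Defensive.

Import Order.TTheory GRing.Theory Num.Theory numFieldNormedType.Exports.

Local Open Scope classical_set_scope.
Local Open Scope ring_scope.
Local Open Scope complex_scope.

(* R[i]^o, the field R[i] regarded as a normed space over itself, carries the
   topology of the complex plane; R[i] alone does not. *)

(* Norms of R[i]-normed spaces take values in R[i]; [rnorm] is the same norm
   with values in R. *)
Definition rnorm (R : realType) (V : normedModType R[i]) (x : V) : R :=
  complex.Re `|x|.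

Section rnorm.
Context {R : realType} {V : normedModType R[i]}.
Implicit Types x y : V.

Lemma rnormE x : (rnorm x)%:C = `|x|.
Proof. by rewrite /rnorm RRe_real ?normr_real. Qed.

Lemma rnorm_ge0 x : 0 <= rnorm x.
Proof. by rewrite -lecR rnormE; exact: normr_ge0. Qed.

Lemma rnormD x y : rnorm (x + y) <= rnorm x + rnorm y.
Proof. by rewrite -lecR rmorphD /= !rnormE ler_normD. Qed.

Lemma rnormZ (a : R[i]) x : rnorm (a *: x) = complex.Re `|a| * rnorm x.
Proof.
apply: (@complexI R); rewrite rmorphM /= !rnormE normrZ.
by rewrite (RRe_real (normr_real a)).
Qed.

Lemma rnorm_eq0 x : rnorm x = 0 -> x = 0.
Proof. by move=> x0; apply/normr0_eq0; rewrite -rnormE x0. Qed.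

Lemma rnorm0 : rnorm (0 : V) = 0.
Proof. by rewrite /rnorm normr0. Qed.

End rnorm.

(* Since [sup] is 0 on unbounded sets, this is the operator norm only when [f]
   is linear and continuous. *)
Definition opnorm (R : realType) (V W : normedModType R[i]) (f : V -> W) : R :=
  sup [set rnorm (f x) | x in [set x : V | rnorm x <= 1]].

Section opnorm.
Context {R : realType} {V W : normedModType R[i]}.
Variables (f : V -> W) (lf : linear f) (cf : continuous f).

Let fL : {linear V -> W} := HB.pack f (GRing.isLinear.Build _ _ _ _ _ lf).

Lemma opnorm_has_sup :
  has_sup [set rnorm (f x) | x in [set x : V | rnorm x <= 1]].
Proof.
split; first by exists (rnorm (f 0)), 0 => //=; rewrite rnorm0.
have : bounded_near fL (nbhs (0 : V)).
  exact/linear_bounded_continuous.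
move=> /linear_boundedP/pinfty_ex_gt0[M M0 fM].
exists (complex.Re M) => _ [x /= x1 <-].
have MR : (complex.Re M)%:C = M by apply: RRe_real; apply: gtr0_real.
rewrite -lecR MR rnormE (le_trans (fM x))// ler_piMr ?(ltW M0)//.
by move: x1; rewrite -lecR rnormE.
Qed.

Lemma opnorm_ge0 : 0 <= opnorm f.
Proof.
apply: le_trans (ub_le_sup opnorm_has_sup.2 _); last first.
  by exists 0 => //=; rewrite rnorm0.
exact: rnorm_ge0.
Qed.

Lemma ler_opnorm x : rnorm (f x) <= opnorm f * rnorm x.
Proof.
have [x0|x0] := eqVneq (rnorm x) 0.
  have f0 : f 0 = 0 := linear0 fL.
  by rewrite (rnorm_eq0 x0) f0 !rnorm0 mulr0.
have px : 0 < rnorm x by rewrite lt_def x0 rnorm_ge0.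
have nV : complex.Re `|((rnorm x)^-1)%:C : R[i]| = (rnorm x)^-1.
  have : 0 <= ((rnorm x)^-1)%:C by rewrite (lecR 0) invr_ge0 ltW.
  by move=> /ger0_norm ->.
have fZ (a : R[i]) : f (a *: x) = a *: f x := linearZZ fL a x.
rewrite -ler_pdivrMr// mulrC -nV -rnormZ -fZ.
apply: (ub_le_sup opnorm_has_sup.2); exists (((rnorm x)^-1)%:C *: x) => //=.
by rewrite rnormZ nV mulVf.
Qed.

Lemma opnorm_le (M : R) :
  (forall x, rnorm x <= 1 -> rnorm (f x) <= M) -> opnorm f <= M.
Proof.
move=> fM; apply: ge_sup; first exact: opnorm_has_sup.1.
by move=> _ [x /= x1 <-]; exact: fM.
Qed.

End opnorm.

Section dual.
Context {R : realType} (X : normedModType R[i]).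

Definition dual_pred : {pred X -> R[i]^o} :=
  fun f => `[< linear f /\ continuous f >].

Lemma dual_submod_closed : submod_closed dual_pred.
Proof.
split=> [|a f g /asboolP[lf cf] /asboolP[lg cg]].
  apply/asboolP; split; last by move=> x; exact: cvg_cst.
  by move=> a x y /=; rewrite [RHS](_ : _ = a *: 0 + 0)// scaler0 addr0.
apply/asboolP; split.
  move=> b x y; have E z : (a *: f + g) z = a *: f z + g z by [].
  rewrite !E lf lg !scalerDr !scalerA [a * b]mulrC.
  by rewrite addrACA.
by move=> x; apply: cvgD; [apply: cvgZr; exact: cf|exact: cg].
Qed.

HB.instance Definition _ :=
  GRing.isSubmodClosed.Build R[i] (X -> R[i]^o) dual_pred dual_submod_closed.

Record dual := Dual { dual_fun :> X -> R[i]^o ; _ : dual_fun \in dual_pred }.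

HB.instance Definition _ := [isSub for dual_fun].
HB.instance Definition _ := [Choice of dual by <:].
HB.instance Definition _ := [SubChoice_isSubLmodule of dual by <:].

Lemma dual_linear (f : dual) : linear f.
Proof. by case: f => f /= /asboolP[]. Qed.

Lemma dual_continuous (f : dual) : continuous (f : X -> R[i]^o).
Proof. by case: f => f /= /asboolP[]. Qed.

Definition dual_norm (f : dual) : R[i] := (opnorm f)%:C.

Lemma dual_normD f g : dual_norm (f + g) <= dual_norm f + dual_norm g.
Proof.
rewrite /dual_norm -rmorphD lecR; apply: opnorm_le.
- exact: dual_linear.
- exact: dual_continuous.
move=> x x1; apply: le_trans (rnormD _ _) _.
apply: lerD; [have h := ler_opnorm (@dual_linear f) (@dual_continuous f) x|
  have h := ler_opnorm (@dual_linear g) (@dual_continuous g) x];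
  apply: le_trans h _; rewrite ler_piMr// opnorm_ge0//;
  by [exact: dual_linear|exact: dual_continuous].
Qed.

Lemma dual_normZ_le (a : R[i]) (f : dual) :
  dual_norm (a *: f) <= `|a| * dual_norm f.
Proof.
rewrite /dual_norm -(RRe_real (normr_real a)) -rmorphM lecR.
apply: opnorm_le.
- exact: dual_linear.
- exact: dual_continuous.
move=> x x1; rewrite [X in rnorm X](_ : _ = a *: (f x))// rnormZ.
rewrite ler_wpM2l//.
  by rewrite -lecR RRe_real ?normr_real//; exact: normr_ge0.
apply: le_trans (ler_opnorm (@dual_linear f) (@dual_continuous f) x) _.
by rewrite ler_piMr// opnorm_ge0//; [exact: dual_linear|exact: dual_continuous].
Qed.

Lemma dual_normZ (a : R[i]) (f : dual) :
  dual_norm (a *: f) = `|a| * dual_norm f.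
Proof.
apply/eqP; rewrite eq_le dual_normZ_le /=.
have [->|a0] := eqVneq a 0.
  rewrite normr0 mul0r /dual_norm lecR opnorm_ge0//.
    exact: dual_linear.
  exact: dual_continuous.
rewrite -[in leLHS](scalerK a0 f) -ler_pdivlMl ?normr_gt0//.
by rewrite -normfV dual_normZ_le.
Qed.

Lemma dual_norm_eq0 (f : dual) : dual_norm f = 0 -> f = 0.
Proof.
move=> [f0]; apply/val_inj/funext => x /=.
apply/rnorm_eq0/eqP; rewrite eq_le rnorm_ge0 andbT.
have := ler_opnorm (@dual_linear f) (@dual_continuous f) x.
by rewrite f0 mul0r.
Qed.

HB.instance Definition _ := Lmodule_isNormed.Build R[i] dual
  dual_normD dual_normZ dual_norm_eq0.

End dual.

Section adjoint.
Context {R : realType} {X : normedModType R[i]}.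
Variables (T : {linear X -> X}) (cT : continuous T).

Lemma adjoint_subproof (f : dual X) :
  (f \o T : X -> R[i]^o) \in @dual_pred R X.
Proof.
apply/asboolP; split.
  by move=> a x y /=; rewrite linearP dual_linear.
by move=> x; apply: continuous_comp; [exact: cT|exact: dual_continuous].
Qed.

Definition adjoint (f : dual X) : dual X := Dual (adjoint_subproof f).

Lemma adjoint_linear : linear adjoint.
Proof. by move=> a f g; exact/val_inj. Qed.

HB.instance Definition _ :=
  GRing.isLinear.Build R[i] (dual X) (dual X) _ adjoint adjoint_linear.

End adjoint.

(* A linear subspace M, as a normed space for the norm induced by X. *)
Section subspace.
Context {R : realType} {X : normedModType R[i]} (M : submodClosed X).

Record subsp := Subsp { subsp_val :> X ; _ : subsp_val \in M }.

HB.instance Definition _ := [isSub for subsp_val].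
HB.instance Definition _ := [Choice of subsp by <:].
HB.instance Definition _ := [SubChoice_isSubLmodule of subsp by <:].

Definition subsp_norm (x : subsp) : R[i] := `|val x|.

Lemma subsp_normD x y : subsp_norm (x + y) <= subsp_norm x + subsp_norm y.
Proof. exact: ler_normD. Qed.

Lemma subsp_normZ (a : R[i]) x : subsp_norm (a *: x) = `|a| * subsp_norm x.
Proof. exact: normrZ. Qed.

Lemma subsp_norm_eq0 x : subsp_norm x = 0 -> x = 0.
Proof. by move=> /normr0_eq0 x0; exact/val_inj. Qed.

HB.instance Definition _ := Lmodule_isNormed.Build R[i] subsp
  subsp_normD subsp_normZ subsp_norm_eq0.

End subspace.

Definition invariant_subspace (R : realType) (X : normedModType R[i])
    (T : X -> X) (M : submodClosed X) : Prop :=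
  forall x, x \in M -> T x \in M.

Section restriction.
Context {R : realType} {X : normedModType R[i]}.
Variables (T : {linear X -> X}) (M : submodClosed X).
Variable TM : invariant_subspace T M.

Lemma restriction_subproof (x : subsp M) : T (val x) \in M.
Proof. by apply: TM; exact: valP. Qed.

Definition restriction (x : subsp M) : subsp M :=
  Subsp (restriction_subproof x).

Lemma restriction_linear : linear restriction.
Proof. by move=> a x y; apply: val_inj => /=; rewrite linearP. Qed.

HB.instance Definition _ :=
  GRing.isLinear.Build R[i] (subsp M) (subsp M) _ restriction
    restriction_linear.

End restriction.

Section operators.
Context {R : realType} {X : normedModType R[i]}.
Implicit Types (T : {linear X -> X}) (A B : set X) (M N : submodClosed X).

Definition infinite_dimensional (V : lmodType R[i]) : Prop :=
  forall (n : nat) (e : 'I_n -> V),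
    exists x : V, forall c : 'I_n -> R[i], x <> \sum_i c i *: e i.

Definition quasinilpotent_part T : set X :=
  [set x | (fun n => rnorm (iter n T x) `^ n%:R^-1) @ \oo --> (0 : R)].

(* Only the values u 1, u 2, ... of the sequence are used. *)
Definition analytical_core T : set X :=
  [set x | exists (u : nat -> X) (delta : R),
    [/\ 0 < delta,
        T (u 1%N) = x,
        (forall n, (0 < n)%N -> T (u n.+1) = u n) &
        (forall n, (0 < n)%N -> rnorm (u n) <= delta ^+ n * rnorm x)]].

(* X is the algebraic direct sum of A and B. *)
Definition direct_sum A B : Prop :=
  (forall x, exists a b, [/\ A a, B b & x = a + b]) /\ A `&` B = [set 0].

Definition right_generalized_Drazin_invertible T : Prop :=
  closed (analytical_core T) /\
  exists N, [/\ closed [set` N],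
                direct_sum (analytical_core T) [set` N],
                invariant_subspace T N &
                [set` N] `<=` quasinilpotent_part T].

Definition semi_regular T : Prop :=
  closed (range T) /\ forall n, [set x | iter n T x = 0] `<=` range T.

(* Spectral radius zero; on the space {0} every operator is quasinilpotent. *)
Definition quasinilpotent T : Prop :=
  (fun n => opnorm (iter n T) `^ n%:R^-1) @ \oo --> (0 : R).

(* f is given near z0 by a convergent power series with coefficients in X. *)
Definition analytic_at (f : R[i]^o -> X) (z0 : R[i]^o) : Prop :=
  exists a : nat -> X, \forall z \near z0,
    series (fun n => (z - z0) ^+ n *: a n) @ \oo --> f z.

(* An analytic function U -> X is represented by a total function, whose values
   outside the open set U are irrelevant. *)
Definition SVEP_at T (l0 : R[i]^o) : Prop :=
  forall U : set R[i]^o, open U -> connected U -> U l0 ->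
  forall f : R[i]^o -> X,
    (forall l, U l -> analytic_at f l) ->
    (forall l, U l -> l *: f l - T (f l) = 0) ->
    forall l, U l -> f l = 0.

End operators.

Definition is_GKD (R : realType) (X : normedModType R[i])
    (T : {linear X -> X}) (M N : submodClosed X) : Prop :=
  [/\ closed [set` M], closed [set` N], direct_sum [set` M] [set` N] &
    exists (TM : invariant_subspace T M) (TN : invariant_subspace T N),
      semi_regular (restriction TM) /\ quasinilpotent (restriction TN)].

(* Main.v *)
Require Import Defs.
From HB Require Import structures.
From mathcomp Require Import all_boot all_order all_algebra.
From mathcomp Require Import complex ring lra.
From mathcomp Require Import all_classical all_reals all_analysis.
Import Order.TTheory GRing.Theory Num.Theory numFieldNormedType.Exports.
Local Open Scope classical_set_scope.
Local Open Scope ring_scope.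
Local Open Scope complex_scope.

(** Suppose that X = K(T) + N with N inside the quasinilpotent part.  T maps
    K(T) onto itself, so T is trivially semi-regular there
    ([core_surjective]); on N the pointwise condition ||T^n x||^(1/n) -> 0
    becomes uniform by the uniform boundedness principle
    ([restriction_quasinilpotent]).  For the single-valued extension property,
    an eigenvector phi of the adjoint for the eigenvalue l satisfies
    phi (T^n x) = l^n phi(x).  If x has a backward orbit of geometric growth
    this forces phi(x) = 0 for small l ([eigen_core0]), and if x is in the
    quasinilpotent part it forces phi(x) = 0 for l <> 0
    ([eigen_quasinilpotent_part0]).  So an analytic family f of eigenvectors
    satisfies f(l)(x) = 0 for small l <> 0, for x in K(T) and for x in N, and
    the identity theorem ([analytic_identity]) propagates this to the whole
    connected domain ([SVEP_adjoint]).

    Conversely, let (M, N) be a generalized Kato decomposition.  The point is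
    that T maps M onto M.  If not, T(M) is a proper closed subspace of M and
    the Hahn-Banach theorem gives phi_0 <> 0 that kills T(M) + N
    ([cokernel_functional]).  Semi-regularity puts all kernels of powers of
    T|M inside T(M), so phi_0 kills them; hence Tm + k |-> phi_0(m) is a well
    defined bounded functional on T(M) + N, whose extension phi_1 again kills
    N and these kernels, and satisfies phi_1 o T = phi_0
    ([kills_kernels_lift]).  Iterating gives phi_n with
    phi_(n+1) o T = phi_n and geometric growth, the growth rate coming from the
    open mapping theorem, and f(z) = sum_n z^n phi_n is an analytic family of
    eigenvectors of the adjoint with f(0) = phi_0, against the single-valued
    extension property ([SVEP_backward_orbit]).  Once T(M) = M, the open
    mapping theorem builds backward orbits of geometric growth in M, so M is
    contained in K(T); the N-component of a point of K(T) is
    T^n applied to vectors of geometric growth in N, so it vanishes because T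
    is quasinilpotent on N.  Hence K(T) = M ([core_eq]).

    The Banach space theory is developed for linear relations rather than
    maps: the open mapping theorem for a closed linear relation
    ([open_mapping_relation]) contains at once the boundedness of the
    projection of a direct sum and that of the inverse of an operator with
    closed range, and the Hahn-Banach theorem for a linear relation
    ([hahn_banach]) extends functionals that are only given through
    representatives, such as Tm + k |-> phi(m). *)

Set Implicit Arguments.
Unset Strict Implicit.
Unset Printing Implicit Defensive.

(** * Real-valued norms *)

Section basics.
Context {R : realType}.
Implicit Types (V W : normedModType R[i]).

Lemma rnormN V (x : V) : rnorm (- x) = rnorm x.
Proof. by rewrite /rnorm normrN. Qed.

Lemma rnormBC V (x y : V) : rnorm (x - y) = rnorm (y - x).
Proof. by rewrite -rnormN opprB. Qed.

Lemma rnorm_triangle V (z x y : V) :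
  rnorm (x - y) <= rnorm (x - z) + rnorm (z - y).
Proof. by rewrite -[x - y](subrKA z) rnormD. Qed.

Lemma rnormZE V (a : R[i]) (x : V) :
  rnorm (a *: x) = rnorm (a : R[i]^o) * rnorm x.
Proof. exact: rnormZ. Qed.

Lemma rnormX (a : R[i]) n : rnorm (a ^+ n : R[i]^o) = rnorm (a : R[i]^o) ^+ n.
Proof.
apply: (@complexI R); rewrite rmorphXn /= [LHS](@rnormE _ R[i]^o).
by rewrite [in RHS](@rnormE _ R[i]^o) normrX.
Qed.

Lemma rnormM (a b : R[i]) :
  rnorm (a * b : R[i]^o) = rnorm (a : R[i]^o) * rnorm (b : R[i]^o).
Proof. exact: (@rnormZ R R[i]^o). Qed.

Lemma rnorm_def (a : R[i]) :
  rnorm (a : R[i]^o) = Num.sqrt (complex.Re a ^+ 2 + complex.Im a ^+ 2).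
Proof. by rewrite /rnorm [`|_|](@normc_def R a). Qed.

Lemma rnorm_real (r : R) : rnorm (r%:C : R[i]^o) = `|r|.
Proof.
by rewrite rnorm_def /= expr0n addr0 sqrtr_sqr.
Qed.

Lemma rnormZ_ge0 V (r : R) (x : V) : 0 <= r -> rnorm (r%:C *: x) = r * rnorm x.
Proof. by move=> r0; rewrite rnormZE rnorm_real ger0_norm. Qed.

Lemma rnorm_nat n : rnorm (n%:R : R[i]^o) = n%:R.
Proof. by rewrite -(rmorph_nat (real_complex R)) rnorm_real ger0_norm. Qed.

Lemma Re_le_rnorm (a : R[i]) : `|complex.Re a| <= rnorm (a : R[i]^o).
Proof. by rewrite rnorm_def /= -sqrtr_sqr ler_wsqrtr// lerDl sqr_ge0. Qed.

Lemma Im_le_rnorm (a : R[i]) : `|complex.Im a| <= rnorm (a : R[i]^o).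
Proof. by rewrite rnorm_def /= -sqrtr_sqr ler_wsqrtr// lerDr sqr_ge0. Qed.

Lemma rnorm_le_ReIm (a : R[i]) :
  rnorm (a : R[i]^o) <= `|complex.Re a| + `|complex.Im a|.
Proof.
rewrite {1}[a]complexE; apply: le_trans (rnormD _ _) _.
rewrite lerD// ?rnorm_real// rnormM rnorm_real ler_piMl//.
by rewrite rnorm_def /= expr0n expr1n add0r sqrtr1.
Qed.

Lemma rnorm_gt0 V (x : V) : x != 0 -> 0 < rnorm x.
Proof.
move=> x0; rewrite lt_def rnorm_ge0 andbT.
by apply: contra x0 => /eqP/rnorm_eq0/eqP.
Qed.

Lemma rnorm_sum V (I : Type) (r : seq I) (P : pred I) (F : I -> V) :
  rnorm (\sum_(i <- r | P i) F i) <= \sum_(i <- r | P i) rnorm (F i).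
Proof.
elim/big_ind2 : _ => [|x a y b xa yb|//]; first by rewrite rnorm0.
by apply: le_trans (rnormD _ _) _; rewrite lerD.
Qed.

Lemma pos_complexP (e : R[i]) : 0 < e -> exists2 r : R, 0 < r & e = r%:C.
Proof.
case: e => a b; rewrite ltcE /= => /andP[/eqP -> a0]; exists a => //.
Qed.

Lemma nbhs_rnormP V (x : V) (A : set V) :
  nbhs x A <-> exists2 r : R, 0 < r & forall y, rnorm (x - y) < r -> A y.
Proof.
split=> [/nbhs_normP[e /= /pos_complexP[r r0 ->]] xA|[r r0 xA]].
  by exists r => // y xy; apply: xA; rewrite /= -rnormE ltcR.
apply/nbhs_normP; exists r%:C => /=; first by rewrite (ltcR 0).
by move=> y /=; rewrite -rnormE ltcR => /xA.
Qed.

Lemma cvg_rnormP V (T : Type) (F : set_system T) (FF : Filter F) (f : T -> V)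
    (y : V) :
  f @ F --> y <-> forall e : R, 0 < e -> \forall t \near F, rnorm (y - f t) < e.
Proof.
apply: (iff_trans (@cvgrPdist_lt _ _ _ _ _ _ _)); split=> h e e0.
  have /h : 0 < e%:C by rewrite (ltcR 0).
  by apply: filterS => t; rewrite -rnormE ltcR.
case/pos_complexP: e0 => r r0 ->.
by apply: filterS (h _ r0) => t; rewrite -rnormE ltcR.
Qed.
End basics.

Lemma submodB (K : pzRingType) (V : lmodType K) (F : submodClosed V) (x y : V) :
  x \in F -> y \in F -> x - y \in F.
Proof. by move=> Fx Fy; rewrite -scaleN1r rpredD// rpredZ. Qed.

(** * Geometric convergence, boundedness and closedness *)

Section geometric.
Context {R : realType}.

Lemma eq_ler (x y : R) : x = y -> x <= y.
Proof. by move=> ->. Qed.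

Lemma half01 : 0 <= (2^-1 : R) < 1.
Proof. by apply/andP; split; lra. Qed.

Lemma geometric_bound_ge0 (V : normedModType R[i]) (u : nat -> V) (C d : R) :
  (forall n, rnorm (u n) <= C * d ^+ n) -> 0 <= C.
Proof.
by move=> /(_ 0%N); rewrite expr0 mulr1; apply: le_trans; exact: rnorm_ge0.
Qed.

Lemma geometric_small (D rho e : R) : 0 <= rho < 1 -> 0 < e ->
  \forall n \near \oo, D * rho ^+ n < e.
Proof.
move=> /andP[rho0 rho1] e0.
have /cvgrPdist_lt/(_ e e0) : geometric D rho @ \oo --> 0.
  by apply: cvg_geometric; rewrite ger0_norm.
apply: filterS => n; rewrite sub0r normrN /=.
exact: le_lt_trans (ler_norm _).
Qed.

(** A telescoping sum of a geometric series.  The bound D (1 - rho) rho^n on the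
    increments is normalised so that the tail starting at n is exactly
    D rho^n.  [N] is any seminorm-like function, in order to cover both
    [rnorm] and the absolute value of R. *)
Lemma geometric_dist (V : zmodType) (N : V -> R) (u : nat -> V) (D rho : R) :
  0 <= rho < 1 -> 0 <= D -> N 0 = 0 -> (forall x y, N (x + y) <= N x + N y) ->
  (forall n, N (u n.+1 - u n) <= D * (1 - rho) * rho ^+ n) ->
  forall n k, N (u (n + k)%N - u n) <= D * rho ^+ n.
Proof.
move=> /andP[rho0 rho1] D0 N0 ND uD n k.
suff h : N (u (n + k)%N - u n) <= D * rho ^+ n * (1 - rho ^+ k).
  apply: le_trans h _; rewrite ler_piMr ?mulr_ge0 ?exprn_ge0//.
  by rewrite gerBl exprn_ge0.
elim: k => [|k IH]; first by rewrite addn0 subrr N0 expr0 subrr mulr0.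
rewrite addnS -[X in N X](subrKA (u (n + k)%N)).
apply: le_trans (ND _ _) _; apply: le_trans (lerD (uD _) IH) _.
by rewrite exprD exprS; apply: eq_ler; ring.
Qed.

Lemma cvg_rnorm_le (V : normedModType R[i]) (u : nat -> V) (l a : V) (M : R) :
  u @ \oo --> l -> (\forall n \near \oo, rnorm (u n - a) <= M) ->
  rnorm (l - a) <= M.
Proof.
move=> /cvg_rnormP ul uM; apply/ler_addgt0Pr => e e0.
have [n [h1 h2]] := filter_ex (filterI (ul e e0) uM).
by apply: le_trans (rnorm_triangle (u n) _ _) _; rewrite addrC lerD// ltW.
Qed.

Lemma geometric_cauchy_cvg (X : completeNormedModType R[i]) (u : nat -> X)
    (D rho : R) :
  0 <= rho < 1 -> 0 <= D ->
  (forall n, rnorm (u n.+1 - u n) <= D * (1 - rho) * rho ^+ n) ->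
  exists l, u @ \oo --> l /\ forall n, rnorm (l - u n) <= D * rho ^+ n.
Proof.
move=> rho01 D0 uD.
have dist := geometric_dist rho01 D0 rnorm0 (@rnormD _ X) uD.
have : cvg (u @ \oo).
  apply: cauchy_cvg; apply: cauchy_exP => _ /= /pos_complexP[e e0 ->].
  have [n un] := filter_ex (geometric_small D rho01 e0).
  exists (u n); exists n => // m /= /subnKC <-.
  rewrite -ball_normE /= -rnormE ltcR rnormBC.
  exact: le_lt_trans (dist _ _) un.
case/cvg_ex => l ul; exists l; split=> // n.
apply: (cvg_rnorm_le ul); exists n => // m /= /subnKC <-; exact: dist.
Qed.

Lemma bounded_linear_continuous (V W : normedModType R[i]) (f : V -> W)
    (C : R) :
  linear f -> (forall x, rnorm (f x) <= C * rnorm x) -> continuous f.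
Proof.
move=> lf fC x; apply/cvg_rnormP => e e0.
pose fL : {linear V -> W} := HB.pack f (GRing.isLinear.Build _ _ _ _ _ lf).
have C1 : 0 < `|C| + 1 by rewrite ltr_pwDr.
apply/nbhs_rnormP; exists (e / (`|C| + 1)); first by rewrite divr_gt0.
move=> y; rewrite ltr_pdivlMr// => xy.
rewrite -(linearB fL) /=; apply: le_lt_trans (fC _) _.
apply: le_lt_trans xy; rewrite mulrC ler_wpM2l ?rnorm_ge0//.
by rewrite (le_trans (ler_norm _))// lerDl.
Qed.

Lemma continuous_linear_bounded (V W : normedModType R[i]) (f : V -> W) :
  linear f -> continuous f ->
  exists2 C, 0 < C & forall x, rnorm (f x) <= C * rnorm x.
Proof.
move=> lf cf; exists (opnorm f + 1).
  by rewrite ltr_pwDr// opnorm_ge0.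
move=> x; apply: le_trans (ler_opnorm lf cf x) _.
by rewrite ler_wpM2r ?rnorm_ge0// lerDl.
Qed.

Lemma closed_cvg_nat (V : normedModType R[i]) (A : set V) (u : nat -> V)
    (l : V) :
  closed A -> (forall n, A (u n)) -> u @ \oo --> l -> A l.
Proof.
move=> cA uA; apply: (closed_cvg (u_ := u)) => //.
by apply: nearW.
Qed.

Lemma closed_rnormP (V : normedModType R[i]) (A : set V) :
  closed A <->
  forall x, (forall e : R, 0 < e -> exists2 y, A y & rnorm (x - y) < e) -> A x.
Proof.
split=> [cA x xA|h x cx].
  apply: cA => B /nbhs_rnormP[r r0 rB].
  by have [y Ay /rB By] := xA r r0; exists y.
apply: h => e e0; have [|y [Ay xy]] := cx [set y | rnorm (x - y) < e].
  by apply/nbhs_rnormP; exists e.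
by exists y.
Qed.

End geometric.

(** * Baire category and its consequences *)

Section category.
Context {R : realType}.

(** Baire's theorem in the form used below: if countably many sets cover a
    nonempty closed set, one of them is dense in a relative ball.  Otherwise
    one could choose successively smaller balls, the n-th of which avoids the
    n-th set; the limit of their centres would lie in no set of the cover. *)
Lemma baire_closed (X : completeNormedModType R[i]) (F : set X)
    (A : nat -> set X) :
  closed F -> F !=set0 -> (forall y, F y -> exists n, A n y) ->
  exists n y0 (r : R), [/\ F y0, 0 < r &
    forall y, F y -> rnorm (y0 - y) < r ->
    forall e : R, 0 < e -> exists2 z, A n z & rnorm (y - z) < e].
Proof.
move=> cF [y0 Fy0] covA; apply: contrapT => nex.
have step (np : nat * (X * R)) : exists q : X * R, F np.2.1 -> 0 < np.2.2 ->
    [/\ F q.1, 0 < q.2, rnorm (q.1 - np.2.1) <= np.2.2, q.2 <= np.2.2 / 2 &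
      forall z, A np.1 z -> 3 * q.2 <= rnorm (q.1 - z)].
  case: np => n [p r] /=.
  have [[Fp r0]|np] := pselect (F p /\ 0 < r); last first.
    by exists (p, r) => Fp r0; case: np.
  have [y [Fy py [e [e0 yA]]]] : exists y, [/\ F y, rnorm (p - y) < r &
      exists e : R, 0 < e /\ forall z, A n z -> e <= rnorm (y - z)].
    apply: contrapT => h; apply: nex; exists n, p, r; split=> // y Fy py e e0.
    apply: contrapT => h'; apply: h; exists y; split=> //; exists e; split=> //.
    move=> z Az; rewrite leNgt; apply/negP => yz; apply: h'; by exists z.
  (* The limit ends up within 2 q.2 of q.1; the factor 3 keeps it away from
     the n-th set. *)
  exists (y, Num.min (e / 3) (r / 2)) => _ _ /=; split=> //.
  - by rewrite lt_min !divr_gt0.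
  - by rewrite rnormBC ltW.
  - by rewrite ge_min lexx orbT.
  move=> z /yA; apply: le_trans.
  have : Num.min (e / 3) (r / 2) <= e / 3 by rewrite ge_min lexx.
  by lra.
have [f fP] := choice step.
pose fix p n : X * R := if n is m.+1 then f (m, p m) else (y0, 1).
have pP n : F (p n).1 /\ 0 < (p n).2.
  by elim: n => [|n [IH1 IH2]]; [split | have [] := fP (n, p n) IH1 IH2].
pose P n := fP (n, p n) (pP n).1 (pP n).2.
have rk n k : (p (n + k)%N).2 <= (p n).2 * 2^-1 ^+ k.
  elim: k => [|k IH]; first by rewrite addn0 expr0 mulr1.
  rewrite addnS exprS; have [_ _ _ /= h _] := P (n + k)%N.
  by move: IH h; set a := _ ^+ k; set b := (p _).2; nra.
have h01 := @half01 R.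
have stepn n k : rnorm ((p (n + k.+1)%N).1 - (p (n + k)%N).1) <=
    (2 * (p n).2) * (1 - 2^-1) * 2^-1 ^+ k.
  rewrite addnS; have [_ _ /= h _ _] := P (n + k)%N.
  apply: le_trans h _; apply: le_trans (rk _ _) _.
  by apply: eq_ler; field.
have D0 n : 0 <= 2 * (p n).2 by rewrite mulr_ge0// ltW// (pP n).2.
have [l [ul _]] := geometric_cauchy_cvg h01 (D0 0%N) (stepn 0%N).
have Fl : F l by apply: (closed_cvg_nat cF _ ul) => n; exact: (pP _).1.
have [n Anl] := covA l Fl.
have [_ _ _ _ /(_ l Anl)] := P n; apply/negP; rewrite -ltNge.
have : rnorm (l - (p n.+1).1) <= 2 * (p n.+1).2.
  apply: (cvg_rnorm_le ul); exists n.+1 => // m /= /subnKC <-.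
  have := geometric_dist h01 (D0 n.+1) rnorm0 (@rnormD _ X) (stepn n.+1) 0
    (m - n.+1).
  by rewrite addn0 expr0 mulr1.
rewrite rnormBC; have := (pP n.+1).2; rewrite /=; lra.
Qed.

(** The points where all [S n] are bounded by k cover F when k varies, so they
    fill a ball relative to F by Baire; a vector of F is a scaled difference of
    two points of this ball. *)
Lemma uniform_boundedness (X : completeNormedModType R[i]) (F : submodClosed X)
    (S : nat -> {linear X -> X}) :
  closed [set` F] -> (forall n, continuous (S n)) ->
  (forall x, x \in F -> exists M : R, forall n, rnorm (S n x) <= M) ->
  exists C : R, forall n x, x \in F -> rnorm (S n x) <= C * rnorm x.
Proof.
move=> cF cS bS.
pose A k := [set x | forall n, rnorm (S n x) <= k%:R].
have [||k [y0 [r [Fy0 r0 yA]]]] := @baire_closed X [set` F] A cF.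
- by exists 0; rewrite /= rpred0.
- move=> y /bS[M yM]; exists (Num.truncn M).+1 => n.
  apply: le_trans (yM n) _; exact/ltW/truncnS_gt.
have {}yA y : y \in F -> rnorm (y0 - y) < r -> A k y.
  move=> Fy y0y n; apply/ler_addgt0Pr => e e0.
  have lSn : linear (S n) by move=> a u v; rewrite linearP.
  have [C C0 SC] := continuous_linear_bounded lSn (cS n).
  have [|z Az yz] := yA y Fy y0y (e / C); first by rewrite divr_gt0.
  rewrite -(subrK (S n z) (S n y)); apply: le_trans (rnormD _ _) _.
  rewrite addrC lerD ?Az// -linearB; apply: le_trans (SC _) _.
  by rewrite mulrC -ler_pdivlMr// ltW.
exists (4 * k%:R / r) => n x Fx.
have [->|x0] := eqVneq x 0; first by rewrite linear0 !rnorm0 mulr0.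
have px := rnorm_gt0 x0.
pose s : R := r / (2 * rnorm x).
have s0 : 0 < s by rewrite divr_gt0// mulr_gt0.
have nsx (V : normedModType R[i]) (v : V) : rnorm (s%:C *: v) = s * rnorm v.
  by rewrite rnormZ_ge0// ltW.
have A0 : A k y0 by apply: yA => //; rewrite subrr rnorm0.
have A1 : A k (y0 + s%:C *: x).
  apply: yA; first by rewrite rpredD// rpredZ.
  rewrite opprD addNKr rnormN nsx /s invfM mulrA divfK ?gt_eqF//.
  by rewrite ltr_pdivrMr// ltr_pMr// ltr1n.
have : s * rnorm (S n x) <= 2 * k%:R.
  rewrite -nsx -linearZ -[X in S n X](addKr y0) addrC linearB.
  by apply: le_trans (rnormD _ _) _; rewrite rnormN mulrDl mul1r lerD.
rewrite mulrC -ler_pdivlMr// => h; apply: le_trans h _.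
apply: eq_ler.
by rewrite /s; field; rewrite !gt_eqF.
Qed.

(** The open mapping theorem for a closed linear relation with closed range.
    By Baire the points related to a vector of norm at most n are dense in a
    ball of the range for some n, so every y in the range can be approximated
    within half its norm by some y' related to a vector of norm at most
    K |y|.  Repeating this with the remainder y - y' and summing the vectors
    found gives an exact solution, of norm at most 2 K |y|. *)
Lemma open_mapping_relation (X Y : completeNormedModType R[i])
    (G : X -> Y -> Prop) :
  G 0 0 ->
  (forall a x y x' y', G x y -> G x' y' -> G (a *: x + x') (a *: y + y')) ->
  (forall u v x y, (forall n, G (u n) (v n)) ->
     u @ \oo --> x -> v @ \oo --> y -> G x y) ->
  closed [set y | exists x, G x y] ->
  exists2 C : R, 0 < C &
    forall x y, G x y -> exists2 x', G x' y & rnorm x' <= C * rnorm y.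
Proof.
move=> G0 linG cG; set F := [set y | _] => cF.
have GZ a x y : G x y -> G (a *: x) (a *: y).
  by move=> /linG/(_ G0); move=> /(_ a); rewrite !addr0.
have GD x y x' y' : G x y -> G x' y' -> G (x + x') (y + y').
  by move=> /linG h /h => /(_ 1); rewrite !scale1r.
have GB x y x' y' : G x y -> G x' y' -> G (x - x') (y - y').
  by move=> Gx /(GZ (-1)); rewrite !scaleN1r; exact: GD.
have FZ a y : F y -> F (a *: y) by move=> [x /(GZ a)]; exists (a *: x).
have FD y y' : F y -> F y' -> F (y + y').
  by move=> [x Gx] [x' Gx']; exists (x + x'); exact: GD.
have FB y y' : F y -> F y' -> F (y - y').
  by move=> [x Gx] [x' Gx']; exists (x - x'); exact: GB.
pose A n := [set y | exists2 x, G x y & rnorm x <= n%:R].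
have [||n [y0 [r [Fy0 r0 yA]]]] := @baire_closed Y F A cF.
- by exists 0, 0.
- move=> y [x Gx]; exists (Num.truncn (rnorm x)).+1, x => //.
  exact/ltW/truncnS_gt.
have small y e : F y -> rnorm y < r -> 0 < e -> exists x' y',
    [/\ G x' y', rnorm x' <= 2 * n%:R & rnorm (y - y') < e].
  move=> Fy yr e0; have e2 : 0 < e / 2 by rewrite divr_gt0.
  have [||z1 [x1 G1 x1n] z1e] := yA (y0 + y) _ _ _ e2.
  - exact: FD.
  - by rewrite opprD addNKr rnormN.
  have [||z2 [x2 G2 x2n] z2e] := yA y0 _ _ _ e2 => //.
    by rewrite subrr rnorm0.
  exists (x1 - x2), (z1 - z2); split; first exact: GB.
    by apply: le_trans (rnormD _ _) _; rewrite rnormN mulrDl mul1r lerD.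
  rewrite [X in rnorm X](_ : _ = (y0 + y - z1) - (y0 - z2)); last first.
    rewrite !opprB [y0 + y]addrC -!addrA; congr (y + _).
    by rewrite [RHS]addrC -!addrA addNr addr0 addrC.
  by apply: le_lt_trans (rnormD _ _) _; rewrite rnormN (splitr e) ltrD.
pose K : R := 4 * n%:R / r + 1.
have K0 : 0 < K by rewrite ltr_pwDr// divr_ge0// ?mulr_ge0// ltW.
have approx y : exists p : X * Y, F y ->
    [/\ G p.1 p.2, rnorm p.1 <= K * rnorm y &
        rnorm (y - p.2) <= 2^-1 * rnorm y].
  have [Fy|nFy] := pselect (F y); last by exists (0, 0).
  have [->|yn0] := eqVneq y 0.
    by exists (0, 0) => _ /=; rewrite subr0 !rnorm0 !mulr0.
  have py := rnorm_gt0 yn0.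
  pose s : R := r / (2 * rnorm y).
  have s0 : 0 < s by rewrite divr_gt0// mulr_gt0.
  have sC0 : s%:C != 0 by rewrite (inj_eq (@complexI R)) gt_eqF.
  have nsx (V : normedModType R[i]) (v : V) : rnorm (s%:C *: v) = s * rnorm v.
    by rewrite rnormZ_ge0// ltW.
  have nsV (V : normedModType R[i]) (v : V) :
      rnorm (s%:C^-1 *: v) = s^-1 * rnorm v.
    by rewrite -fmorphV rnormZE rnorm_real gtr0_norm// invr_gt0.
  have [|||x' [y' [G' xn' ye']]] := small (s%:C *: y) (s * (rnorm y / 2)).
  - exact: FZ.
  - rewrite nsx /s invfM mulrA divfK ?gt_eqF//.
    by rewrite ltr_pdivrMr// ltr_pMr// ltr1n.
  - by rewrite mulr_gt0// divr_gt0.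
  exists (s%:C^-1 *: x', s%:C^-1 *: y') => _ /=; split; first exact: GZ.
    rewrite nsV; apply: (@le_trans _ _ (s^-1 * (2 * n%:R))).
      by rewrite ler_wpM2l// invr_ge0 ltW.
    rewrite [leLHS](_ : _ = (4 * n%:R / r) * rnorm y).
      by rewrite ler_wpM2r ?rnorm_ge0// lerDl.
    by rewrite /s; field; rewrite !gt_eqF.
  rewrite -[X in X - _](scalerK sC0) -scalerBr nsV ler_pdivrMl//.
  by rewrite [X in _ <= _ * X]mulrC ltW.
have [f fP] := choice approx.
exists (2 * K); first by rewrite mulr_gt0.
move=> x0 y Gx0; have Fy : F y by exists x0.
pose fix w k := if k is m.+1 then w m - (f (w m)).2 else y.
pose fix x k := if k is m.+1 then x m + (f (w m)).1 else 0.
have Fw k : F (w k).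
  elim: k => [//|k IH] /=; have [h _ _] := fP _ IH.
  by apply: FB => //; exists (f (w k)).1.
have wk k : rnorm (w k) <= rnorm y * 2^-1 ^+ k.
  elim: k => [|k IH] /=; first by rewrite expr0 mulr1.
  have [_ _ h] := fP _ (Fw k); apply: le_trans h _.
  by rewrite exprS mulrCA ler_wpM2l// invr_ge0.
have Gxw k : G (x k) (y - w k).
  elim: k => [|k IH] /=; first by rewrite subrr.
  by rewrite opprB addrCA addrC; apply: GD => //; have [] := fP _ (Fw k).
have h01 := @half01 R.
have [||l [xl lx]] := @geometric_cauchy_cvg _ X x (2 * K * rnorm y) _ h01.
- by rewrite !mulr_ge0// ?rnorm_ge0// ltW.
- move=> k /=; rewrite addrC addKr; have [_ h _] := fP _ (Fw k).
  apply: le_trans h _; apply: (@le_trans _ _ (K * (rnorm y * 2^-1 ^+ k))).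
    by rewrite ler_wpM2l// ltW.
  by apply: eq_ler; field.
exists l; last by have := lx 0%N; rewrite /= subr0 expr0 mulr1.
apply: (cG _ _ _ _ Gxw xl); apply/cvg_rnormP => e e0.
apply: filterS (geometric_small (rnorm y) h01 e0) => k.
by rewrite opprB addrCA subrr addr0; exact: le_lt_trans.
Qed.

End category.

(** * The Hahn-Banach theorem *)

Section hahn_banach.
Context {R : realType} {X : normedModType R[i]}.
Implicit Types (G : set (X * R)) (C : R).

(** A real-linear set of pairs dominated by C |x|; the domination makes it the
    graph of a partial functional ([dominated_graph_unique]). *)
Definition dominated_graph C G :=
  (forall r p q, G p -> G q -> G (r%:C *: p.1 + q.1, r * p.2 + q.2)) /\
  (forall p, G p -> p.2 <= C * rnorm p.1).

Lemma dominated_graph_unique C G x a b :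
  dominated_graph C G -> G (x, a) -> G (x, b) -> a = b.
Proof.
move=> [linG domG].
suff h c d : G (x, c) -> G (x, d) -> c <= d.
  by move=> Ga Gb; apply/eqP; rewrite eq_le !h.
move=> Gc Gd; have /domG /= := linG (-1) _ _ Gd Gc.
by rewrite rmorphN rmorph1 scaleN1r addNr rnorm0 mulr0 mulN1r addrC subr_le0.
Qed.

(** The classical one-dimensional extension: every lower bound
    a - C |x - x0| for the value at [x0] is at most every upper bound
    C |y + x0| - b, so the supremum of the lower bounds is admissible. *)
Lemma dominated_graph_extend C G x0 : 0 <= C ->
  dominated_graph C G -> G (0, 0) ->
  exists a0, dominated_graph C
    [set p | exists q t, G q /\ p = (q.1 + t%:C *: x0, q.2 + t * a0)].
Proof.
move=> C0 [linG domG] G0.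
have GZ r p : G p -> G (r%:C *: p.1, r * p.2).
  by move=> Gp; have := linG r _ _ Gp G0; rewrite /= !addr0.
pose S := [set p.2 - C * rnorm (p.1 - x0) | p in G].
have Sub q : G q -> ubound S (C * rnorm (q.1 + x0) - q.2).
  move=> Gq _ [p Gp <-]; rewrite lerBrDr addrAC lerBlDr -mulrDr.
  have := domG _ (linG 1 _ _ Gp Gq); rewrite /= rmorph1 scale1r mul1r.
  move=> /le_trans; apply; rewrite ler_wpM2l//.
  have -> : p.1 + q.1 = (q.1 + x0) + (p.1 - x0).
    by rewrite addrACA subrr addr0 addrC.
  by rewrite rnormD.
have hS : has_sup S.
  split; first by exists (0 - C * rnorm (0 - x0)), (0, 0).
  by exists (C * rnorm (0 + x0) - 0); exact: (Sub (0, 0)).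
exists (sup S); split=> [r _ _ [p [s [Gp ->]]] [q [t [Gq ->]]]|].
  exists (r%:C *: p.1 + q.1, r * p.2 + q.2), (r * s + t).
  split; first exact: linG.
  congr pair => /=; last by rewrite mulrDr mulrDl addrACA mulrA.
  by rewrite scalerDr rmorphD rmorphM scalerDl addrACA scalerA.
move=> _ [q [t [Gq ->]]] /=.
have [t0|t0|->] := ltgtP t 0; last first.
- by rewrite mul0r scale0r !addr0; exact: domG.
- have tC : t%:C != 0 by rewrite (inj_eq (@complexI R)) gt_eqF.
  have := ge_sup hS.1 (Sub _ (GZ t^-1 _ Gq)); rewrite /= -(ler_pM2l t0).
  rewrite mulrBr mulrCA -(rnormZ_ge0 _ (ltW t0)) scalerDr scalerA -rmorphM.
  rewrite divff ?gt_eqF// rmorph1 scale1r.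
  by rewrite mulrA divff ?gt_eqF// mul1r lerBrDr addrC.
- have s0 : 0 < - t by rewrite oppr_gt0.
  have : (- t)^-1 * q.2 - C * rnorm (((- t)^-1)%:C *: q.1 - x0) <= sup S.
    apply: (ub_le_sup hS.2).
    by exists (((- t)^-1)%:C *: q.1, (- t)^-1 * q.2) => //; exact: GZ.
  rewrite -(ler_pM2l s0) mulrBr [X in _ - X]mulrCA -(rnormZ_ge0 _ (ltW s0)).
  rewrite mulrA scalerBr scalerA -rmorphM divff ?gt_eqF// rmorph1 scale1r.
  by rewrite mul1r rmorphN scaleNr opprK mulNr; lra.
Qed.

Lemma hahn_banach_real C G0 : 0 <= C -> dominated_graph C G0 -> G0 (0, 0) ->
  exists u : X -> R, [/\ forall r x y, u (r%:C *: x + y) = r * u x + u y,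
    forall x, u x <= C * rnorm x & forall p, G0 p -> u p.1 = p.2].
Proof.
move=> C0 dG0 G00.
(* [G0] is adjoined to every set so that the empty chain is bounded too. *)
pose P G := dominated_graph C (G0 `|` G).
have [F FP Ftot|A [PA maxA]] := @Zorn_bigcup _ P.
  have common p q : (G0 `|` \bigcup_(B in F) B) p ->
      (G0 `|` \bigcup_(B in F) B) q -> exists H, [/\ dominated_graph C H,
      H `<=` G0 `|` \bigcup_(B in F) B, H p & H q].
    have Fsub B : F B -> G0 `|` B `<=` G0 `|` \bigcup_(B in F) B.
      by move=> FB z [?|?]; [left | right; exists B].
    move=> [Gp|[B FB Bp]] [Gq|[D FD Dq]].
    - by exists G0; split=> // z; left.
    - by exists (G0 `|` D); split; [exact: FP | exact: Fsub | left | right].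
    - by exists (G0 `|` B); split; [exact: FP | exact: Fsub | right | left].
    - have [BD|DB] := Ftot B D FB FD.
        exists (G0 `|` D).
        split; [exact: FP | exact: Fsub | right; exact: BD | by right].
      exists (G0 `|` B).
      split; [exact: FP | exact: Fsub | by right | right; exact: DB].
  split=> [r p q up uq|p up].
    have [H [dH HF Hp Hq]] := common p q up uq.
    by apply: HF; apply dH.1.
  by have [H [dH HF Hp _]] := common p p up up; apply dH.2.
pose G := G0 `|` A; have {}PA : dominated_graph C G := PA.
have tot x : exists a, G (x, a).
  have [a0 dG'] := dominated_graph_extend x C0 PA (or_introl G00).
  set G' := [set p | _] in dG'.
  have GG' : G `<=` G'.
    by move=> [y b] Gy; exists (y, b), 0; rewrite /= scale0r mul0r !addr0.
  have G'x : G' (x, a0).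
    exists (0, 0), 1; rewrite /= rmorph1 scale1r mul1r !add0r.
    by split=> //; left.
  apply: contrapT => nx; apply: (maxA G'); last first.
    rewrite /P (_ : _ `|` _ = G') //; apply/setUidPr => p Gp.
    by apply: GG'; left.
  split; first by move=> p Ap; apply: GG'; right.
  by move=> /(_ _ G'x) Ax; apply: nx; exists a0; right.
have [u Gu] := choice tot.
exists u; split=> [r x y|x|[x a] Gx].
- apply: (dominated_graph_unique PA (Gu _)).
  exact: (PA.1 r _ _ (Gu x) (Gu y)).
- exact: (PA.2 _ (Gu x)).
- by apply: (dominated_graph_unique PA (Gu _)); left.
Qed.

(** A complex functional is determined by its real part u, as
    x |-> u(x) - i u(ix); so the real theorem is applied to the real parts of
    the values.  The bound passes from u to the complex functional by rotating
    its value at x to a nonnegative real number. *)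
Lemma hahn_banach (G : X -> R[i] -> Prop) C : 0 <= C -> G 0 0 ->
  (forall a x z y w, G x z -> G y w -> G (a *: x + y) (a * z + w)) ->
  (forall x z, G x z -> rnorm (z : R[i]^o) <= C * rnorm x) ->
  exists phi : dual X, (forall x z, G x z -> phi x = z) /\
    forall x, rnorm (phi x) <= C * rnorm x.
Proof.
move=> C0 G0 linG domG.
pose H := [set p : X * R | exists2 z, G p.1 z & p.2 = complex.Re z].
have [||u [linu domu uG]] := @hahn_banach_real C H C0.
- split=> [r [x a] [y b] [z Gz ->] [w Gw ->]|[x a] [z Gz /= ->]].
    exists (r%:C * z + w); first exact: linG.
    by case: z {Gz} => ? ?; case: w {Gw} => ? ? /=; rewrite mul0r subr0.
  apply: le_trans (domG _ _ Gz); apply: le_trans (ler_norm _) _.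
  exact: Re_le_rnorm.
- by exists 0.
pose I : R[i] := 0 +i* 1.
pose f (x : X) : R[i]^o := u x +i* (- u (I *: x)).
have u0 : u 0 = 0.
  by have := uG (0, 0); apply; exists 0.
have uD x y : u (x + y) = u x + u y.
  rewrite -[x]scale1r -(rmorph1 (real_complex R)) linu !mul1r.
  by rewrite rmorph1 scale1r.
have uZ r x : u (r%:C *: x) = r * u x.
  by rewrite -[_ *: _]addr0 linu u0 addr0.
have lf : linear f.
  move=> [p q] x y.
  have E v : (p +i* q) *: v = p%:C *: v + q%:C *: (I *: v).
    rewrite scalerA -scalerDl; congr (_ *: _).
    rewrite /I; apply/eqP; rewrite eq_complex /=.
    by apply/andP; split; apply/eqP; ring.
  have E2 v : I *: (I *: v) = (-1)%:C *: v.
    rewrite scalerA; congr (_ *: _).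
    rewrite /I; apply/eqP; rewrite eq_complex /=.
    by apply/andP; split; apply/eqP; ring.
  have E3 (a b : R[i]^o) :
      a = b <-> complex.Re a = complex.Re b /\ complex.Im a = complex.Im b.
    by case: a; case: b => c d a b /=; split=> [[-> ->]|[-> ->]].
  rewrite /f; apply/E3; split.
    rewrite uD E uD !uZ /=; ring.
  rewrite scalerDr scalerA [I * _]mulrC -scalerA uD !E !uD !uZ E2 uZ /=; ring.
have fC x : rnorm (f x) <= C * rnorm x.
  have [->|fx0] := eqVneq (f x) 0; first by rewrite rnorm0 mulr_ge0 ?rnorm_ge0.
  pose th : R[i] := (rnorm (f x))%:C / f x.
  have thf : th * f x = (rnorm (f x))%:C by rewrite divfK.
  have th1 : rnorm (th : R[i]^o) = 1.
    apply: (@mulIf _ (rnorm (f x))); first by rewrite gt_eqF// rnorm_gt0.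
    by rewrite -rnormM thf rnorm_real ger0_norm ?rnorm_ge0// mul1r.
  pose fL : {linear X -> R[i]^o} :=
    HB.pack f (GRing.isLinear.Build _ _ _ _ _ lf).
  have : f (th *: x) = (rnorm (f x))%:C by rewrite -thf; exact: (linearZZ fL).
  move=> /(congr1 (@complex.Re R)) /= <-; apply: le_trans (domu _) _.
  by rewrite rnormZE th1 mul1r.
have fP : f \in @dual_pred R X.
  by apply/asboolP; split=> //; exact: bounded_linear_continuous lf fC.
exists (Dual fP); split=> // x z Gz /=.
rewrite /f; case: z Gz => a b Gz.
have -> : u x = a by apply: (uG (x, a)); exists (a +i* b).
congr (_ +i* _); apply: oppr_inj; rewrite opprK.
apply: (uG (I *: x, - b)); exists (I * (a +i* b)) => /=.
  by have := linG I _ _ _ _ Gz G0; rewrite !addr0.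
by rewrite mul0r mul1r sub0r.
Qed.

End hahn_banach.

(** * Geometric series in the dual space *)

Section dual_complete.
Context {R : realType}.

Lemma geometric_sum_le (rho : R) n : 0 <= rho < 1 ->
  \sum_(0 <= k < n) rho ^+ k <= (1 - rho)^-1.
Proof.
move=> /andP[r0 r1]; rewrite big_mkord.
have r1' : 0 < 1 - rho by rewrite subr_gt0.
rewrite -[leRHS]mul1r ler_pdivlMr// mulrC -opprB mulNr -subrX1 opprB.
by rewrite gerBl exprn_ge0.
Qed.

Lemma complex_geometric_cvg (z : nat -> R[i]^o) (D rho : R) :
  0 <= rho < 1 -> 0 <= D ->
  (forall n, rnorm (z n.+1 - z n) <= D * (1 - rho) * rho ^+ n) ->
  exists l : R[i]^o, z @ \oo --> l.
Proof.
move=> rho01 D0 zD.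
have part (p : R[i] -> R) : {morph p : x y / x - y} ->
    (forall a, `|p a| <= rnorm (a : R[i]^o)) ->
    exists l : R, (fun n => p (z n)) @ \oo --> l.
  move=> pB ple.
  have /(geometric_dist rho01 D0 (normr0 R) (@ler_normD _ R)) dist n :
      `|p (z n.+1) - p (z n)| <= D * (1 - rho) * rho ^+ n.
    by rewrite -pB; exact: le_trans (ple _) (zD n).
  apply/cvg_ex; apply: cauchy_cvg; apply: cauchy_exP => e e0.
  have [n un] := filter_ex (geometric_small D rho01 e0).
  exists (p (z n)); exists n => // m /= /subnKC <-.
  rewrite /ball /= distrC; exact: le_lt_trans (dist _ _) un.
have [a /cvgrPdist_lt aP] : exists l : R,
    (fun n => complex.Re (z n)) @ \oo --> l.
  by apply: (part (@complex.Re R)) => [[a b] [c d]|a] //; exact: Re_le_rnorm.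
have [b /cvgrPdist_lt bP] : exists l : R,
    (fun n => complex.Im (z n)) @ \oo --> l.
  by apply: (part (@complex.Im R)) => [[c b] [? d]|?] //; exact: Im_le_rnorm.
exists (a +i* b); apply/cvg_rnormP => e e0.
have e2 : 0 < e / 2 by rewrite divr_gt0.
apply: filterS2 (aP _ e2) (bP _ e2) => n an bn.
rewrite (splitr e); apply: le_lt_trans (rnorm_le_ReIm _) _.
by rewrite ltrD//; move: an bn; case: (z n).
Qed.

Context {X : normedModType R[i]}.

Lemma dualD (phi : dual X) x y : phi (x + y) = phi x + phi y.
Proof. by have := dual_linear phi 1 x y; rewrite !scale1r. Qed.

Lemma dualB (phi : dual X) x y : phi (x - y) = phi x - phi y.
Proof. by rewrite addrC -scaleN1r dual_linear scaleN1r addrC. Qed.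

Lemma dual_rnorm_apply (phi : dual X) x : rnorm (phi x) <= rnorm phi * rnorm x.
Proof. by apply: ler_opnorm; [exact: dual_linear | exact: dual_continuous]. Qed.

Lemma dual_rnorm_le (phi : dual X) M : 0 <= M ->
  (forall x, rnorm (phi x) <= M * rnorm x) -> rnorm phi <= M.
Proof.
move=> M0 phiM; apply: opnorm_le => [||x x1].
- exact: dual_linear.
- exact: dual_continuous.
- by apply: le_trans (phiM x) _; rewrite ler_piMr.
Qed.

(** The pointwise limit exists by the completeness of the complex plane, and
    the geometric rate makes it linear, bounded and a limit in norm. *)
Lemma dual_geometric_cvg (s : nat -> dual X) (D rho : R) :
  0 <= rho < 1 -> 0 <= D ->
  (forall n, rnorm (s n.+1 - s n) <= D * (1 - rho) * rho ^+ n) ->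
  exists l : dual X, s @ \oo --> l.
Proof.
move=> rho01 D0 sD.
have sDx x n : rnorm (s n.+1 x - s n x) <=
    (D * rnorm x) * (1 - rho) * rho ^+ n.
  have -> : s n.+1 x - s n x = (s n.+1 - s n) x by [].
  apply: le_trans (dual_rnorm_apply _ _) _.
  apply: le_trans (ler_wpM2r (rnorm_ge0 _) (sD n)) _.
  by apply: eq_ler; ring.
have Dx0 (x : X) : 0 <= D * rnorm x by rewrite mulr_ge0// rnorm_ge0.
have [l lP] := choice (fun x => complex_geometric_cvg rho01 (Dx0 x) (sDx x)).
have ls n x : rnorm (l x - s n x) <= D * rho ^+ n * rnorm x.
  apply: (cvg_rnorm_le (lP x)); exists n => // m /= /subnKC <-.
  have := geometric_dist rho01 (Dx0 x) rnorm0 (@rnormD _ _) (sDx x) n (m - n).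
  by rewrite mulrAC.
have lin : linear l.
  move=> a x y; apply: (@norm_cvg_unique _ R[i]^o _ _ _ _ (lP _)).
  rewrite (_ : (fun _ => _) = (fun n => a *: s n x + s n y)); last first.
    by apply/funext => n; rewrite dual_linear.
  by apply: cvgD; [apply: cvgZl_tmp; exact: lP | exact: lP].
have lC x : rnorm (l x) <= (D + rnorm (s 0%N)) * rnorm x.
  rewrite -(subrK (s 0%N x) (l x)); apply: le_trans (rnormD _ _) _.
  rewrite mulrDl lerD ?dual_rnorm_apply//.
  by have := ls 0%N x; rewrite expr0 mulr1.
have lP' : l \in @dual_pred R X.
  by apply/asboolP; split=> //; exact: bounded_linear_continuous lin lC.
exists (Dual lP'); apply/cvg_rnormP => e e0.
apply: filterS (geometric_small D rho01 e0) => n; apply: le_lt_trans.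
apply: dual_rnorm_le => [|x]; last exact: ls.
by case/andP: rho01 => r0 _; rewrite mulr_ge0// exprn_ge0.
Qed.

Lemma dual_geometric_series (v : nat -> dual X) (C rho : R) :
  0 <= rho < 1 -> 0 <= C -> (forall n, rnorm (v n) <= C * rho ^+ n) ->
  exists l : dual X, series v @ \oo --> l.
Proof.
move=> rho01 C0 vC; have /andP[_ r1] := rho01.
apply: (@dual_geometric_cvg _ (C / (1 - rho)) rho) => //.
  by rewrite divr_ge0// subr_ge0 ltW.
move=> n; rewrite divfK ?gt_eqF ?subr_gt0//.
by rewrite /series /= big_nat_recr//= [X in rnorm X]addrC addKr.
Qed.

End dual_complete.

(** * Power series in the dual space *)

Section power_series.
Context {R : realType} {X : normedModType R[i]}.

(** The binomial formula with K vanishing terms added at the end, so that it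
    can be split at K whether or not K exceeds n. *)
Lemma exprDn_nat (A : comNzRingType) (a b : A) n K :
  (a + b) ^+ n =
  \sum_(0 <= k < K + n.+1) (a ^+ (n - k) * b ^+ k) *+ 'C(n, k).
Proof.
rewrite (@big_cat_nat _ _ _ n.+1) ?leq_addl//=.
rewrite [X in _ = _ + X]big_nat_cond [X in _ = _ + X]big1 ?addr0.
  by rewrite big_mkord exprDn.
by move=> k /andP[/andP[nk _] _]; rewrite bin_small.
Qed.

(** For k >= K each factor |w|^k is at most (|w| / tau)^K tau^k, so the tail of
    the binomial expansion of (z0 + w)^n is at most (|w| / tau)^K times the
    full expansion of (|z0| + tau)^n. *)
Lemma power_tail_le (w z0 : R[i]) (tau : R) n K :
  0 < tau -> rnorm (w : R[i]^o) <= tau ->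
  rnorm ((z0 + w) ^+ n -
         \sum_(0 <= k < K) (z0 ^+ (n - k) * w ^+ k) *+ 'C(n, k) : R[i]^o) <=
  (rnorm (w : R[i]^o) / tau) ^+ K * (rnorm (z0 : R[i]^o) + tau) ^+ n.
Proof.
move=> tau0 wtau.
rewrite (exprDn_nat _ _ _ K) (@big_cat_nat _ _ _ K) ?leq_addr//=.
rewrite [X in rnorm X]addrC addKr; apply: le_trans (rnorm_sum _ _ _) _.
rewrite (exprDn_nat _ _ _ K) [in leRHS](@big_cat_nat _ _ _ K) ?leq_addr//=.
rewrite mulrDr.
rewrite ler_wpDl//.
  apply: mulr_ge0; first by rewrite exprn_ge0// divr_ge0 ?rnorm_ge0 ?ltW.
  apply: sumr_ge0 => k _.
  by rewrite mulrn_wge0// mulr_ge0// exprn_ge0// ?rnorm_ge0// ltW.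
rewrite mulr_sumr ler_sum_nat// => k /andP[Kk _].
have h : rnorm (w : R[i]^o) ^+ k <= (rnorm (w : R[i]^o) / tau) ^+ K * tau ^+ k.
  rewrite -(subnKC Kk) !exprD expr_div_n mulrA divfK ?expf_neq0 ?gt_eqF//.
  by rewrite ler_wpM2l ?exprn_ge0 ?rnorm_ge0// lerXn2r ?nnegrE ?rnorm_ge0// ltW.
rewrite -[X in rnorm X]mulr_natr rnormM rnorm_nat rnormM !rnormX mulr_natr.
by rewrite mulrnAr lerMn2r mulrCA ler_wpM2l ?exprn_ge0 ?rnorm_ge0 ?orbT//.
Qed.

(** Analyticity at a point z0 of the disc requires a re-expansion around z0.
    Its k-th coefficient is the sum over n of 'C(n, k) z0^(n - k) phi_n.  With
    tau such that (|z0| + tau) delta < 1, [power_tail_le] bounds the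
    difference between f(z) and the K-th partial sum of the new series by a
    multiple of (|z - z0| / tau)^K, without interchanging infinite sums. *)
Lemma dual_power_series (phi : nat -> dual X) (C delta : R) :
  0 < delta -> 0 <= C -> (forall n, rnorm (phi n) <= C * delta ^+ n) ->
  exists f : R[i]^o -> dual X, forall z : R[i]^o, rnorm z * delta < 1 ->
    series (fun n => z ^+ n *: phi n) @ \oo --> f z /\ analytic_at f z.
Proof.
move=> d0 C0 phiC.
have termC (a : nat -> R[i]) (D s : R) :
    0 <= s -> s * delta < 1 -> 0 <= D ->
    (forall n, rnorm (a n : R[i]^o) <= D * s ^+ n) ->
    exists l : dual X, series (fun n => a n *: phi n) @ \oo --> l.
  move=> s0 sd D0 aD.
  apply: (@dual_geometric_series _ _ _ (D * C) (s * delta)).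
  - by rewrite sd mulr_ge0// ltW.
  - by rewrite mulr_ge0.
  move=> n; rewrite rnormZE exprMn mulrACA.
  by rewrite ler_pM ?rnorm_ge0.
have fP (z : R[i]^o) : exists l : dual X, rnorm z * delta < 1 ->
    series (fun n => z ^+ n *: phi n) @ \oo --> l.
  have [zd|nzd] := boolP (rnorm z * delta < 1); last first.
    by exists 0 => h; case/negP: nzd.
  have [|n|l hl] := @termC (fun n => z ^+ n) 1 (rnorm z) (rnorm_ge0 _) zd.
  - exact: ler01.
  - by rewrite mul1r rnormX.
  by exists l.
have [f {}fP] := choice fP.
exists f => z0 z0d; split; first exact: fP.
pose r := rnorm z0.
(* half the distance from z0 to the boundary of the disc *)
pose tau : R := (delta^-1 - r) / 2.
have tau0 : 0 < tau.
  by rewrite divr_gt0// subr_gt0 -[X in _ < X]mul1r ltr_pdivlMr.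
have rtd : (r + tau) * delta < 1.
  rewrite (_ : _ * _ = (1 + r * delta) / 2); first by rewrite /r; lra.
  by rewrite /tau; field; rewrite gt_eqF.
have rt0 : 0 <= r + tau by rewrite addr_ge0 ?rnorm_ge0// ltW.
have bP k : exists l : dual X,
    series (fun n => (z0 ^+ (n - k) *+ 'C(n, k)) *: phi n) @ \oo --> l.
  apply: (termC _ (tau ^- k) (r + tau)) => // [|n].
    by rewrite invr_ge0 exprn_ge0// ltW.
  have term_ge0 j : 0 <= (rnorm z0 ^+ (n - j) * tau ^+ j) *+ 'C(n, j).
    by rewrite mulrn_wge0// mulr_ge0// exprn_ge0// ?rnorm_ge0// ltW.
  rewrite ler_pdivlMl ?exprn_gt0// -[X in rnorm X]mulr_natr.
  rewrite rnormM rnorm_nat rnormX.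
  rewrite (exprDn_nat _ _ _ k) (@big_cat_nat _ _ _ k) ?leq_addr//=.
  rewrite ler_wpDl//.
    by apply: sumr_ge0 => j _; exact: term_ge0.
  rewrite big_ltn; last by rewrite addnS ltnS leq_addr.
  rewrite ler_wpDr//; last by rewrite mulrA mulr_natr [tau ^+ k * _]mulrC.
  by apply: sumr_ge0 => j _; exact: term_ge0.
have [b {}bP] := choice bP.
exists b; apply/nbhs_rnormP; exists tau => // z.
rewrite rnormBC; set w := z - z0 => wtau.
have zE : z0 + w = z by rewrite /w addrC subrK.
have zd : rnorm z * delta < 1.
  apply: le_lt_trans rtd; rewrite ler_wpM2r ?(ltW d0)// -zE.
  by apply: le_trans (rnormD _ _) _; rewrite lerD2l ltW.
have rho01 : 0 <= (r + tau) * delta < 1 by rewrite rtd mulr_ge0// ltW.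
have q01 : 0 <= rnorm w / tau < 1.
  by rewrite divr_ge0 ?rnorm_ge0 ?(ltW tau0)//= ltr_pdivrMr// mul1r.
apply/cvg_rnormP => e e0.
apply: filterS (geometric_small (C / (1 - (r + tau) * delta)) q01 e0) => K.
apply: le_lt_trans.
(* [Q N] replaces each coefficient of the K-th partial sum of the new series by
   its N-th partial sum, so only finite sums have to be compared. *)
pose Q N := \sum_(0 <= k < K) w ^+ k *:
  series (fun n => (z0 ^+ (n - k) *+ 'C(n, k)) *: phi n) N.
have QP : Q @ \oo --> series (fun n => w ^+ n *: b n) K.
  rewrite /Q /series /=; elim: (K) => [|m IH].
    under eq_fun do rewrite big_geq//.
    by rewrite big_geq//; exact: cvg_cst.
  under eq_fun do rewrite big_nat_recr//=.
  rewrite big_nat_recr//=; apply: cvgD => //; apply: cvgZl_tmp; exact: bP.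
rewrite -[X in rnorm X <= _]subr0.
apply: (@cvg_rnorm_le _ _ (fun N => series (fun n => z ^+ n *: phi n) N - Q N)).
  by apply: cvgB => //; exact: fP.
apply: nearW => N /=.
rewrite subr0 /Q /series /=.
rewrite [X in _ - X](_ : _ = \sum_(0 <= n < N)
    (\sum_(0 <= k < K) (z0 ^+ (n - k) * w ^+ k) *+ 'C(n, k)) *: phi n);
    last first.
  under eq_bigr do rewrite scaler_sumr.
  rewrite exchange_big; apply: eq_bigr => n _; rewrite scaler_suml.
  by apply: eq_bigr => k _; rewrite scalerA mulrnAr [w ^+ k * _]mulrC.
rewrite -sumrB; apply: le_trans (rnorm_sum _ _ _) _.
apply: (@le_trans _ _ (\sum_(0 <= n < N)
    (C * (rnorm w / tau) ^+ K) * ((r + tau) * delta) ^+ n)).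
  apply: ler_sum => n _; rewrite -scalerBl rnormZE -[X in X ^+ n - _]zE.
  apply: le_trans (ler_pM (rnorm_ge0 _) (rnorm_ge0 _)
    (power_tail_le _ _ _ tau0 (ltW wtau)) (phiC n)) _.
  rewrite [((r + tau) * delta) ^+ n]exprMn -/r.
  set q := _ ^+ K; set p := (r + tau) ^+ n.
  by rewrite [leLHS](_ : _ = C * q * (p * delta ^+ n)) //; ring.
rewrite -mulr_sumr [leRHS]mulrAC ler_wpM2l ?geometric_sum_le//.
by rewrite mulr_ge0// exprn_ge0//; case/andP: q01.
Qed.

End power_series.

(** * The identity theorem *)

Section identity.
Context {R : realType} {V : normedModType R[i]}.

Lemma near_le_bounded (a : nat -> R) (c : R) : (forall n, 0 <= a n) ->
  (\forall n \near \oo, a n <= c) -> exists B, forall n, a n <= B.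
Proof.
move=> a0 [N _ aN]; exists (`|c| + \sum_(0 <= k < N) a k) => n.
have [Nn|nN] := leqP N n.
  by rewrite ler_wpDr ?sumr_ge0// (le_trans (aN n Nn))// ler_norm.
rewrite ler_wpDl// (@big_cat_nat _ _ _ n)//=; last exact: ltnW.
by rewrite ler_wpDl ?sumr_ge0// big_ltn// ler_wpDr// sumr_ge0.
Qed.

Lemma series_terms_bounded (v : nat -> V) (l : V) : series v @ \oo --> l ->
  exists B, forall n, rnorm (v n) <= B.
Proof.
move=> /cvg_rnormP/(_ 1 ltr01)[N _ vN].
apply: (@near_le_bounded _ 2) => [n|]; first exact: rnorm_ge0.
exists N => // n Nn.
rewrite [v n](_ : _ = series v n.+1 - series v n); last first.
  by rewrite /series /= big_nat_recr//= [RHS]addrC addKr.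
apply: le_trans (rnorm_triangle l _ _) _.
rewrite (natrD _ 1 1) lerD// ltW//; last exact: vN.
by rewrite rnormBC; apply: vN => /=; exact: leqW.
Qed.

(** If a_m is the first nonzero coefficient at z0, then g(z) differs from
    a_m (z - z0)^m by a term of order |z - z0|^(m + 1); a zero of g close
    enough to z0 contradicts this. *)
Lemma analytic_zero_near (g : R[i]^o -> V) (z0 : R[i]^o) :
  analytic_at g z0 ->
  (forall r : R, 0 < r ->
    exists z, [/\ z != z0, rnorm (z - z0) < r & g z = 0]) ->
  \forall z \near z0, g z = 0.
Proof.
move=> [a /nbhs_rnormP[r0 r00 ga]] acc.
pose rho := r0 / 2; have rho0 : 0 < rho by rewrite divr_gt0.
have [B aB] : exists B, forall n, rnorm (a n) * rho ^+ n <= B.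
  have [|B BP] := @series_terms_bounded _ _ (ga (z0 + rho%:C) _).
    rewrite opprD addNKr rnormN rnorm_real gtr0_norm//.
    by rewrite ltr_pdivrMr// ltr_pMr// ltr1n.
  exists B => n; apply: le_trans (BP n).
  by rewrite addrC addKr rnormZE rnormX rnorm_real gtr0_norm// mulrC.
have B0 : 0 <= B by apply: le_trans (aB 0%N); rewrite mulr_ge0// rnorm_ge0.
have a0 m : a m = 0.
  elim/ltn_ind: m => m IH.
  apply: rnorm_eq0; apply/eqP; rewrite eq_le rnorm_ge0 andbT.
  pose c := 2 * B / rho ^+ m.+1.
  have c0 : 0 <= c by rewrite divr_ge0 ?mulr_ge0 ?exprn_ge0// ltW.
  apply/ler_addgt0Pr => e e0; rewrite add0r.
  have [|z [zz0 zr gz]] := acc (Num.min (rho / 2) (e / (c + 1))).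
    by rewrite lt_min !divr_gt0//= ltr_pwDr.
  set w := z - z0 in zr *.
  have w0 : 0 < rnorm w by rewrite rnorm_gt0// subr_eq0.
  move: zr; rewrite lt_min => /andP[wrho we].
  have q01 : 0 <= rnorm w / rho < 1.
    rewrite divr_ge0 ?rnorm_ge0 ?(ltW rho0)//= ltr_pdivrMr// mul1r.
    by apply: lt_trans wrho _; rewrite ltr_pdivrMr// ltr_pMr// ltr1n.
  have q2 : (1 - rnorm w / rho)^-1 <= 2.
    have : rnorm w / rho <= 2^-1.
      by rewrite ler_pdivrMr// mulrC ltW.
    move: q01 => /andP[_ q1] q2.
    rewrite -[leRHS]invrK lef_pV2 ?posrE ?invr_gt0 ?subr_gt0//; lra.
  have wa : rnorm w ^+ m * rnorm (a m) <= c * rnorm w ^+ m.+1.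
    rewrite -rnormX -rnormZE -[_ *: a m]subr0 rnormBC.
    have cv : series (fun n => w ^+ n *: a n) @ \oo --> (0 : V).
      rewrite -gz; apply: ga; rewrite rnormBC; apply: lt_trans wrho _.
      by rewrite /rho; lra.
    apply: (cvg_rnorm_le cv); exists m.+1 => // N /= /subnKC <-.
    rewrite /series /= (@big_cat_nat _ _ _ m.+1) ?leq_addr//= big_nat_recr//=.
    rewrite big_nat_cond big1 ?add0r; last first.
      by move=> k /andP[/andP[_ km] _]; rewrite IH ?scaler0.
    rewrite [X in rnorm X]addrC addKr -{1}[m.+1]add0n big_addn addKn.
    apply: le_trans (rnorm_sum _ _ _) _.
    apply: (@le_trans _ _ (\sum_(0 <= k < N - m.+1)
        (B * (rnorm w / rho) ^+ m.+1) * (rnorm w / rho) ^+ k)).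
      apply: ler_sum => k _; rewrite rnormZE rnormX -mulrA -exprD addnC.
      rewrite expr_div_n mulrCA ler_wpM2l ?exprn_ge0 ?rnorm_ge0//.
      by rewrite ler_pdivlMr ?exprn_gt0.
    rewrite -mulr_sumr.
    apply: le_trans (ler_wpM2l _ (geometric_sum_le _ q01)) _.
      by rewrite mulr_ge0// exprn_ge0//; case/andP: q01.
    apply: le_trans (ler_wpM2l _ q2) _.
      by rewrite mulr_ge0// exprn_ge0//; case/andP: q01.
    rewrite /c expr_div_n; apply: eq_ler.
    by field; rewrite expf_neq0// gt_eqF.
  move: wa; rewrite exprS mulrA [c * _ * _]mulrC ler_pM2l ?exprn_gt0// => wa.
  apply: le_trans wa _; move: we; rewrite ltr_pdivlMr ?ltr_pwDr// => we.
  by apply: le_trans (ltW we); rewrite mulrC ler_wpM2l ?rnorm_ge0// lerDl.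
apply/nbhs_rnormP; exists r0 => // z /ga.
rewrite (_ : series _ = cst 0); last first.
  by apply/funext => n; rewrite /series /= big1// => k _; rewrite a0 scaler0.
move=> cv; apply: (norm_cvg_unique cv); exact: cvg_cst.
Qed.

(** The interior Z of the zero set is open and, by [analytic_zero_near], also
    closed relatively to U, so connectedness gives that Z contains U. *)
Lemma analytic_identity (g : R[i]^o -> V) (U : set R[i]^o) (l0 : R[i]^o)
    (r : R) :
  open U -> connected U -> (forall l, U l -> analytic_at g l) -> U l0 ->
  0 < r -> (forall z, z != l0 -> rnorm (z - l0) < r -> g z = 0) ->
  forall z, U z -> g z = 0.
Proof.
move=> oU cU anU Ul0 r0 gz.
pose Z := [set z | g z = 0]^°.
suff h : U `&` Z = U.
  by move=> z; rewrite -h => -[_]; exact: interior_subset.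
apply: cU.
- exists l0; split=> //; apply: (analytic_zero_near (anU _ Ul0)) => e e0.
  have m0 : 0 < Num.min e r / 2 by rewrite divr_gt0// lt_min e0.
  have nm : rnorm (l0 + (Num.min e r / 2)%:C - l0 : R[i]^o) < Num.min e r.
    rewrite [X in rnorm X]addrC addKr rnorm_real gtr0_norm//.
    by rewrite ltr_pdivrMr// ltr_pMr ?ltr1n// lt_min e0.
  have nz : l0 + (Num.min e r / 2)%:C != l0.
    by rewrite -subr_eq0 [X in X != 0]addrC addKr (inj_eq (@complexI R)) gt_eqF.
  exists (l0 + (Num.min e r / 2)%:C); split=> //.
    by apply: lt_le_trans nm _; rewrite ge_min lexx.
  by apply: gz => //; apply: lt_le_trans nm _; rewrite ge_min lexx orbT.
- by exists Z => //; exact: open_interior.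
exists (closure Z); first exact: closed_closure.
apply/seteqP; split=> [z [Uz Zz]|z [Uz cZ]]; split=> //.
  exact: subset_closure.
have [//|nZ] := pselect (Z z).
apply: (analytic_zero_near (anU _ Uz)) => e e0.
have [|y [Zy zy]] := cZ [set y | rnorm (z - y) < e].
  by apply/nbhs_rnormP; exists e.
exists y; split; last exact: (interior_subset Zy).
  by apply/eqP => yz; apply: nZ; rewrite -yz.
by rewrite rnormBC.
Qed.

End identity.

(** * Orbits, the analytical core and eigenvectors of the adjoint *)

Section orbits.
Context {R : realType}.

Lemma root_cvg0P (a : nat -> R) : (forall n, 0 <= a n) ->
  (fun n => a n `^ n%:R^-1) @ \oo --> (0 : R) <->
  forall e : R, 0 < e -> \forall n \near \oo, a n <= e ^+ n.
Proof.
move=> a0; split=> [/cvgrPdist_lt ha e e0|ha].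
  apply: filterS2 (ha e e0) (nbhs_infty_gt 0%N) => n.
  rewrite sub0r normrN ger0_norm ?powR_ge0// => ane n0.
  have {1}-> : a n = (a n `^ n%:R^-1) ^+ n.
    by rewrite -powR_mulrn ?powR_ge0// -powRrM mulVf ?powRr1// pnatr_eq0 -lt0n.
  by rewrite lerXn2r ?nnegrE ?powR_ge0// ltW.
apply/cvgrPdist_lt => e e0; have e2 : 0 < e / 2 by rewrite divr_gt0.
apply: filterS2 (ha _ e2) (nbhs_infty_gt 0%N) => n ane n0.
rewrite sub0r normrN ger0_norm ?powR_ge0//.
apply: (@le_lt_trans _ _ (e / 2)).
  2: by rewrite ltr_pdivrMr// ltr_pMr// ltr1n.
have -> : e / 2 = ((e / 2) ^+ n) `^ n%:R^-1.
  rewrite -powR_mulrn ?(ltW e2)// -powRrM divff ?powRr1 ?(ltW e2)//.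
  by rewrite pnatr_eq0 -lt0n.
by rewrite ge0_ler_powR ?nnegrE ?invr_ge0// exprn_ge0// ltW.
Qed.

Context {X : normedModType R[i]} (T : {linear X -> X}).

Lemma iter_linear n : linear (iter n T).
Proof.
elim: n => [//|n IH] a x y; rewrite !iterS IH.
exact: linearP.
Qed.

Lemma iterB n x y : iter n T (x - y) = iter n T x - iter n T y.
Proof.
by rewrite -(scaleN1r y) -(scaleN1r (iter n T y)) addrC iter_linear addrC.
Qed.

Lemma iter_bounded C : 0 <= C -> (forall x, rnorm (T x) <= C * rnorm x) ->
  forall n x, rnorm (iter n T x) <= C ^+ n * rnorm x.
Proof.
move=> C0 TC; elim=> [|n IH] x /=; first by rewrite expr0 mul1r.
by apply: le_trans (TC _) _; rewrite exprS -mulrA ler_wpM2l.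
Qed.

Lemma iter_continuous n : continuous T -> continuous (iter n T).
Proof.
move=> cT; have lT : linear T by move=> a x y; rewrite linearP.
have [C C0 TC] := continuous_linear_bounded lT cT.
exact: bounded_linear_continuous (iter_linear n) (iter_bounded (ltW C0) TC n).
Qed.

Lemma quasinilpotent_partP x : quasinilpotent_part T x <->
  forall e : R, 0 < e -> \forall n \near \oo, rnorm (iter n T x) <= e ^+ n.
Proof. by apply: root_cvg0P => n; exact: rnorm_ge0. Qed.

(** The bound delta^n |x| of the definition is not stable under sums or
    under T, since |x| can be small.  A free constant in front of the geometric
    term gives an equivalent condition that is; for x <> 0 the constant is
    absorbed in the rate, and for x = 0 the zero orbit is used. *)
Lemma analytical_coreP x : analytical_core T x <->
  exists (u : nat -> X) (C d : R), [/\ 0 < d, u 0%N = x,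
    forall n, T (u n.+1) = u n & forall n, rnorm (u n) <= C * d ^+ n].
Proof.
split=> [[u [d [d0 u1 uT ud]]]|[u [C [d [d0 u0 uT ud]]]]].
  exists (fun n => if n is 0%N then x else u n), (rnorm x), d; split=> //.
    by case=> // n; exact: uT.
  by case=> [|n]; rewrite mulrC ?expr0 ?mul1r// ud.
have [x0|x0] := eqVneq x 0.
  exists (fun=> 0), 1; rewrite x0; split=> //; first exact: linear0.
    by move=> n _; exact: linear0.
  by move=> n _; rewrite rnorm0 mulr0.
pose m := Num.max 1 (C / rnorm x).
have m1 : 1 <= m by rewrite le_max lexx.
have mC : C <= m * rnorm x.
  by rewrite -ler_pdivrMr ?rnorm_gt0// le_max lexx orbT.
exists u, (d * m); split=> //; first by rewrite mulr_gt0// (lt_le_trans ltr01).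
  by rewrite uT.
move=> n n0; apply: le_trans (ud n) _; rewrite exprMn mulrC -mulrA.
rewrite ler_wpM2l ?exprn_ge0 ?(ltW d0)//; apply: le_trans mC _.
by rewrite ler_wpM2r ?rnorm_ge0// ler_eXnr.
Qed.

Definition core_pred : {pred X} := fun x => `[<analytical_core T x>].

Lemma core_submod_closed : submod_closed core_pred.
Proof.
split=> [|a x y /asboolP/analytical_coreP[u [C [c [c0 u0 uT uc]]]]
  /asboolP/analytical_coreP[v [D [d [d0 v0 vT vd]]]]];
  apply/asboolP/analytical_coreP.
  exists (fun=> 0), 0, 1; split=> // n; first exact: linear0.
  by rewrite rnorm0 mul0r.
have C0 : 0 <= C := geometric_bound_ge0 uc.
have D0 : 0 <= D := geometric_bound_ge0 vd.
exists (fun n => a *: u n + v n), (rnorm (a : R[i]^o) * C + D), (Num.max c d).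
split=> [|||n]; first by rewrite lt_max c0.
- by rewrite u0 v0.
- by move=> n; rewrite linearP uT vT.
have h e : 0 < e -> e <= Num.max c d -> e ^+ n <= Num.max c d ^+ n.
  by move=> e0 ec; rewrite lerXn2r ?nnegrE ?(ltW e0)// (le_trans (ltW e0)).
apply: le_trans (rnormD _ _) _; rewrite mulrDl lerD//.
  rewrite rnormZE -mulrA ler_wpM2l ?rnorm_ge0//; apply: le_trans (uc n) _.
  by rewrite ler_wpM2l// h// le_max lexx.
apply: le_trans (vd n) _.
by rewrite ler_wpM2l// h// le_max lexx orbT.
Qed.

HB.instance Definition _ :=
  GRing.isSubmodClosed.Build R[i] X core_pred core_submod_closed.

Lemma core_stable x : analytical_core T x -> analytical_core T (T x).
Proof.
move=> /analytical_coreP[u [C [d [d0 u0 uT ud]]]]; apply/analytical_coreP.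
exists (fun n => if n is m.+1 then u m else T x), (rnorm (T x) + C / d), d.
have C0 : 0 <= C := geometric_bound_ge0 ud.
split=> //; first by case=> //; rewrite u0.
case=> [|n].
  by rewrite expr0 mulr1 lerDl divr_ge0// ltW.
rewrite mulrDl ler_wpDl ?mulr_ge0 ?exprn_ge0 ?rnorm_ge0 ?(ltW d0)//.
by rewrite exprS mulrA divfK ?gt_eqF.
Qed.

Lemma core_surjective x : analytical_core T x ->
  exists2 y, analytical_core T y & T y = x.
Proof.
move=> /analytical_coreP[u [C [d [d0 u0 uT ud]]]].
exists (u 1%N); last by rewrite uT u0.
apply/analytical_coreP; exists (fun n => u n.+1), (C * d), d; split=> // n.
by rewrite -mulrA -exprS.
Qed.

Lemma eigen_iter (phi : dual X) (l : R[i]) :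
  (forall x, phi (T x) = l * phi x) ->
  forall n x, phi (iter n T x) = l ^+ n * phi x.
Proof.
move=> phiT; elim=> [|n IH] x /=; first by rewrite expr0 mul1r.
by rewrite phiT IH exprS mulrA.
Qed.

(** If T^n (u n) = x and |u n| <= C d^n, then |phi x| = |l|^n |phi (u n)| is
    at most |phi| C (|l| d)^n, which tends to 0 when |l| d < 1. *)
Lemma eigen_core0 x : analytical_core T x ->
  exists2 r : R, 0 < r & forall (phi : dual X) (l : R[i]),
    (forall y, phi (T y) = l * phi y) -> rnorm (l : R[i]^o) < r -> phi x = 0.
Proof.
move=> /analytical_coreP[u [C [d [d0 u0 uT ud]]]].
exists d^-1; first by rewrite invr_gt0.
move=> phi l phiT; rewrite -[X in _ < X]mul1r ltr_pdivlMr// => ld.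
have xE n : x = iter n T (u n).
  by elim: n => [//|n IH]; rewrite iterSr uT.
apply: rnorm_eq0; apply/eqP; rewrite eq_le rnorm_ge0 andbT.
apply/ler_addgt0Pr => e e0; rewrite add0r.
have h01 : 0 <= rnorm (l : R[i]^o) * d < 1.
  by rewrite ld mulr_ge0 ?rnorm_ge0 ?ltW.
have [n hn] := filter_ex (geometric_small (rnorm phi * C) h01 e0).
apply: le_trans (ltW hn); rewrite (xE n) (eigen_iter phiT) rnormM rnormX.
rewrite exprMn mulrCA ler_wpM2l ?exprn_ge0 ?rnorm_ge0//.
apply: le_trans (dual_rnorm_apply _ _) _; rewrite -mulrA ler_wpM2l ?rnorm_ge0//.
Qed.

(** |l|^n |phi x| = |phi (T^n x)| is eventually at most |phi| (|l| / 2)^n. *)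
Lemma eigen_quasinilpotent_part0 x (phi : dual X) (l : R[i]) :
  quasinilpotent_part T x -> (forall y, phi (T y) = l * phi y) -> l != 0 ->
  phi x = 0.
Proof.
move=> /quasinilpotent_partP xq phiT l0.
have nl : 0 < rnorm (l : R[i]^o) by rewrite rnorm_gt0.
apply: rnorm_eq0; apply/eqP; rewrite eq_le rnorm_ge0 andbT.
apply/ler_addgt0Pr => e e0; rewrite add0r.
have h01 := @half01 R.
have nl2 : 0 < rnorm (l : R[i]^o) / 2 by rewrite divr_gt0.
have [n [hn xn]] := filter_ex (filterI (geometric_small (rnorm phi) h01 e0)
  (xq _ nl2)).
apply: le_trans (ltW hn).
have ln : 0 < rnorm (l : R[i]^o) ^+ n by rewrite exprn_gt0.
rewrite -(ler_pM2l ln) -rnormX -rnormM -(eigen_iter phiT).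
apply: le_trans (dual_rnorm_apply _ _) _.
by rewrite rnormX mulrCA -exprMn ler_wpM2l ?rnorm_ge0.
Qed.

Lemma dual_seriesE (v : nat -> dual X) n x :
  (series v n) x = series (fun k => v k x : R[i]^o) n.
Proof.
rewrite /series /=; elim: n => [|n IH]; first by rewrite !big_geq.
by rewrite !big_nat_recr//= -IH.
Qed.

Lemma dual_cvg_apply (s : nat -> dual X) (l : dual X) x :
  s @ \oo --> l -> (fun n => s n x : R[i]^o) @ \oo --> (l x : R[i]^o).
Proof.
move=> /cvg_rnormP sl; apply/cvg_rnormP => e e0.
have x1 : 0 < rnorm x + 1 by rewrite ltr_pwDr// rnorm_ge0.
have /sl : 0 < e / (rnorm x + 1) by rewrite divr_gt0.
apply: filterS => n; rewrite ltr_pdivlMr// => h; apply: le_lt_trans h.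
have -> : l x - s n x = (l - s n) x by [].
apply: le_trans (dual_rnorm_apply _ _) _.
by rewrite ler_wpM2l ?rnorm_ge0// lerDl.
Qed.

Lemma dual_analytic_apply (f : R[i]^o -> dual X) (z0 : R[i]^o) x :
  analytic_at f z0 -> analytic_at (fun z => f z x : R[i]^o) z0.
Proof.
move=> [a fa]; exists (fun n => a n x); apply: filterS fa => z.
move=> h; have := dual_cvg_apply h (x := x).
by under eq_fun do rewrite dual_seriesE.
Qed.

End orbits.

(** * From Drazin invertibility to a Kato decomposition *)

Section Drazin_to_Kato.
Context {R : realType} {X : completeNormedModType R[i]}.
Variables (T : {linear X -> X}) (cT : continuous T) (N : submodClosed X).
Hypothesis Nq : [set` N] `<=` quasinilpotent_part T.

(** The uniform boundedness principle applied to the operators e^-n T^n, which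
    are pointwise bounded on N. *)
Lemma quasinilpotent_part_uniform : closed [set` N] ->
  forall e : R, 0 < e -> exists C : R, forall n x, x \in N ->
    rnorm (iter n T x) <= C * e ^+ n * rnorm x.
Proof.
move=> cN e e0.
pose S n (x : X) : X := (e ^- n)%:C *: iter n T x.
have lS n : linear (S n).
  by move=> a x y; rewrite /S iter_linear scalerDr !scalerA mulrC.
have en n : 0 <= e ^- n by rewrite invr_ge0 exprn_ge0// ltW.
pose SL n : {linear X -> X} :=
  HB.pack (S n) (GRing.isLinear.Build _ _ _ _ _ (lS n)).
have [||C CP] := @uniform_boundedness _ X N SL cN.
- move=> n x; apply: cvgZl_tmp; exact: iter_continuous.
- move=> x /Nq/quasinilpotent_partP/(_ e e0) xe.
  apply: (@near_le_bounded _ _ 1) => [n|]; first exact: rnorm_ge0.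
  apply: filterS xe => n xn; rewrite /= /S rnormZ_ge0//.
  by rewrite mulrC ler_pdivrMr ?exprn_gt0// mul1r.
exists C => n x /(CP n); rewrite /= /S rnormZ_ge0// mulrC.
by rewrite ler_pdivrMr ?exprn_gt0// mulrAC.
Qed.

Lemma restriction_continuous (M : submodClosed X)
    (TM : invariant_subspace T M) :
  continuous (restriction TM).
Proof.
have lT : linear T by move=> a x y; rewrite linearP.
have [C C0 TC] := continuous_linear_bounded lT cT.
apply: (@bounded_linear_continuous _ _ _ _ C); first exact: restriction_linear.
by move=> x; exact: TC.
Qed.

Lemma iter_restriction (M : submodClosed X) (TM : invariant_subspace T M) n
    (x : subsp M) :
  val (iter n (restriction TM) x) = iter n T (val x).
Proof. by elim: n => //= n <-. Qed.

(** The constant of [quasinilpotent_part_uniform] is absorbed by applying it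
    with half the rate. *)
Lemma restriction_quasinilpotent (TN : invariant_subspace T N) :
  closed [set` N] -> quasinilpotent (restriction TN).
Proof.
move=> cN.
have lN n := @iter_linear _ _ (restriction TN) n.
have cTN n :=
  @iter_continuous _ _ (restriction TN) n (@restriction_continuous N TN).
apply/root_cvg0P => [n|e e0]; first exact: opnorm_ge0.
have e2 : 0 < e / 2 by rewrite divr_gt0.
have [C CP] := quasinilpotent_part_uniform cN e2.
have h01 := @half01 R.
apply: filterS (geometric_small (`|C|) h01 ltr01) => n hn.
apply: opnorm_le => // x x1.
have -> : rnorm (iter n (restriction TN) x) = rnorm (iter n T (val x)).
  by rewrite -iter_restriction.
apply: le_trans (CP n _ (valP x)) _.
have en : 0 <= (e / 2) ^+ n by rewrite exprn_ge0// ltW.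
apply: le_trans (ler_wpM2r (rnorm_ge0 _) (ler_wpM2r en (ler_norm C))) _.
apply: (@le_trans _ _ (`|C| * (e / 2) ^+ n)).
  by rewrite ler_piMr// mulr_ge0.
by rewrite exprMn mulrCA ler_piMr ?exprn_ge0 ?(ltW e0)// ltW.
Qed.

(** Each scalar function z |-> f z x is analytic and vanishes for small z <> 0
    when x is in K(T) or in N.  The radius depends on x, which is harmless
    because the identity theorem is applied to one x at a time. *)
Lemma SVEP_adjoint : direct_sum (analytical_core T) [set` N] ->
  SVEP_at (adjoint cT) 0.
Proof.
move=> [dsum _] U oU cU U0 f anf eqf l Ul.
have eig z x : U z -> f z (T x) = z * f z x.
  move=> Uz; have /(congr1 (fun phi : dual X => phi x)) := eqf z Uz.
  by move=> /eqP; rewrite [X in X == _]/= subr_eq0 => /eqP.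
have [r r0 rU] := (nbhs_rnormP _ _).1 (open_nbhs_nbhs (conj oU U0)).
have anx x z : U z -> analytic_at (fun z => f z x : R[i]^o) z.
  by move=> /anf; exact: dual_analytic_apply.
apply/val_inj/funext => x.
suff : f l x = 0 by [].
have [a [b [Ka Nb ->]]] := dsum x.
rewrite dualD.
have -> : f l a = 0.
  have [s s0 sa] := eigen_core0 Ka.
  have m0 : 0 < Num.min r s by rewrite lt_min r0.
  apply: (analytic_identity oU cU (anx a) U0 m0 _ Ul) => z _.
  rewrite subr0 lt_min => /andP[zr zs]; apply: sa zs => y.
  by apply: eig; apply: rU; rewrite sub0r rnormN.
rewrite add0r.
apply: (analytic_identity oU cU (anx b) U0 r0 _ Ul) => z z0.
rewrite subr0 => zr; apply: (eigen_quasinilpotent_part0 (Nq Nb) _ z0) => y.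
by apply: eig; apply: rU; rewrite sub0r rnormN.
Qed.

End Drazin_to_Kato.

Lemma right_generalized_Drazin_GKD (R : realType)
    (X : completeNormedModType R[i]) (T : {linear X -> X}) (cT : continuous T) :
  right_generalized_Drazin_invertible T ->
  (exists M N : submodClosed X, is_GKD T M N) /\ SVEP_at (adjoint cT) 0.
Proof.
move=> [cK [N [cN dsum TN Nq]]]; split; last exact: SVEP_adjoint dsum.
pose M : submodClosed X := core_pred T.
have ME : [set` M] = analytical_core T.
  by apply/seteqP; split=> x /asboolP.
have TM : invariant_subspace T M.
  by move=> x /asboolP/core_stable/asboolP.
exists M, N; split; rewrite ?ME//; exists TM, TN; split; last first.
  exact: restriction_quasinilpotent.
have onto : range (restriction TM) = setT.
  apply/seteqP; split=> // -[x /= xM] _.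
  have [y Ky Ty] := core_surjective (asboolW xM).
  have My : y \in M by apply/asboolP.
  by exists (Subsp My) => //; exact: val_inj.
by split=> [|n x _]; rewrite onto//; exact: closedT.
Qed.

(** * Backward orbits of functionals *)

Section backward_orbits.
Context {R : realType} {X : normedModType R[i]}.
Variables (T : {linear X -> X}) (cT : continuous T).

Lemma disc_open (C : R) : 0 < C -> open [set z : R[i]^o | rnorm z * C < 1].
Proof.
move=> C0; rewrite openE => z /= Uz.
apply/nbhs_rnormP; exists ((1 - rnorm z * C) / C).
  by rewrite divr_gt0// subr_gt0.
move=> y; rewrite ltr_pdivlMr// => zy /=.
apply: (@le_lt_trans _ _ ((rnorm z + rnorm (z - y)) * C)).
  rewrite ler_wpM2r ?(ltW C0)// addrC -{1}[y](subrK z) [rnorm (z - y)]rnormBC.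
  exact: rnormD.
by rewrite mulrDl addrC -ltrBrDr.
Qed.

Lemma disc_connected (C : R) : 0 < C ->
  connected [set z : R[i]^o | rnorm z * C < 1].
Proof.
move=> C0; set U := [set z | _].
pose seg (z : R[i]^o) := [set t%:C *: z | t in `[(0 : R), 1]].
have -> : U = \bigcup_(z in U) seg z.
  apply/seteqP; split=> [z Uz|_ [z Uz [t /= + <-]]].
    by exists z => //; exists 1; rewrite ?scale1r//= in_itv/= lexx ler01.
  rewrite in_itv /= => /andP[t0 t1]; rewrite /U /= rnormZ_ge0//.
  by apply: le_lt_trans Uz; rewrite ler_wpM2r ?(ltW C0)// ler_piMl ?rnorm_ge0.
apply: bigcup_connected.
  by exists 0 => z _; exists 0; rewrite ?scale0r//= in_itv/= lexx ler01.
move=> z _; apply: connected_continuous_connected.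
  exact: segment_connected.
apply: continuous_subspaceT => t; apply/cvg_rnormP => e e0.
have z1 : 0 < rnorm z + 1 by rewrite ltr_pwDr// rnorm_ge0.
apply/nbhs_normP; exists (e / (rnorm z + 1)); first by rewrite /= divr_gt0.
move=> s /=; rewrite ltr_pdivlMr// => ts; apply: le_lt_trans ts.
rewrite -scalerBl -rmorphB rnormZE rnorm_real.
by rewrite ler_wpM2l// lerDl.
Qed.

(** The adjoint maps phi_(n+1) to phi_n and phi_0 to 0, so the sum f(z) of
    z^n phi_n satisfies T^* f(z) = z f(z): applying T^* shifts the series by one
    index.  The single-valued extension property gives f(0) = phi_0 = 0. *)
Lemma SVEP_backward_orbit (phi : nat -> dual X) (C d : R) :
  0 < d -> SVEP_at (adjoint cT) 0 ->
  (forall x, phi 0%N (T x) = 0) -> (forall n x, phi n.+1 (T x) = phi n x) ->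
  (forall n, rnorm (phi n) <= C * d ^+ n) -> phi 0%N = 0.
Proof.
move=> d0 svep phi0T phiT phid.
have [f fP] := dual_power_series d0 (geometric_bound_ge0 phid) phid.
have f0 : f 0 = phi 0%N.
  have [|h _] := fP 0; first by rewrite rnorm0 mul0r.
  apply: (norm_cvg_unique h); apply: cvg_near_cst; exists 1%N => // n /= n0.
  rewrite /series /= big_ltn// expr0 scale1r big_nat_cond big1 ?addr0// => k.
  by move=> /andP[/andP[k0 _] _]; rewrite expr0n gtn_eqF// scale0r.
have U0 : rnorm (0 : R[i]^o) * d < 1 by rewrite rnorm0 mul0r.
rewrite -f0.
apply: (svep _ (disc_open d0) (disc_connected d0) U0 f _ _ 0 U0) => z Uz.
  by have [] := fP z Uz.
have [cf _] := fP z Uz.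
apply/val_inj/funext => x; apply/eqP; rewrite subr_eq0; apply/eqP.
rewrite [LHS](_ : _ = z * f z x)// [RHS](_ : _ = f z (T x))//.
have c1 := dual_cvg_apply cf (x := T x).
have c2 := cvgZl_tmp (k := z) (dual_cvg_apply cf (x := x)).
have c3 : (fun n => z *: (series (fun k => z ^+ k *: phi k) n x : R[i]^o)) @ \oo
    --> (f z (T x) : R[i]^o).
  rewrite -(cvg_shiftS _) in c1.
  apply: cvg_trans c1; apply: near_eq_cvg; apply: nearW => n /=.
  rewrite !dual_seriesE /series /= big_nat_recl//=.
  rewrite [X in X + _](_ : _ = z ^+ 0 * phi 0%N (T x))// phi0T mulr0 add0r.
  rewrite scaler_sumr; apply: eq_bigr => k _.
  by rewrite [LHS](_ : _ = z ^+ k.+1 * phi k.+1 (T x))// phiT exprS -mulrA.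
exact: (@norm_cvg_unique _ R[i]^o _ _ _ _ (c2 _) c3).
Qed.

End backward_orbits.

(** * Bounded projections *)

Section projection.
Context {R : realType} {X : completeNormedModType R[i]}.
Variables (M N : submodClosed X).
Hypotheses (cM : closed [set` M]) (cN : closed [set` N]).
Hypothesis (dsum : direct_sum [set` M] [set` N]).

Lemma direct_sum_unique x m m' :
  m \in M -> m' \in M -> x - m \in N -> x - m' \in N -> m = m'.
Proof.
move=> Mm Mm' Nm Nm'; apply/eqP; rewrite -subr_eq0; apply/eqP.
have : ([set` M] `&` [set` N]) (m - m').
  split; first exact: submodB.
  rewrite /= (_ : m - m' = (x - m') - (x - m)); first exact: submodB.
  by rewrite opprB [RHS]addrC addrA subrK.
by rewrite dsum.2.
Qed.

(** The relation between y and its M-component is closed since M and N are, so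
    the open mapping theorem bounds the component. *)
Lemma direct_sum_projection : exists (P : X -> X) (C : R), [/\ 0 < C,
  forall x, P x \in M, forall x, x - P x \in N &
  forall x, rnorm (P x) <= C * rnorm x].
Proof.
pose G m y := m \in M /\ y - m \in N.
have onto y : exists m, G m y.
  have [m [k [Mm Nk ->]]] := dsum.1 y.
  by exists m; split=> //; rewrite addrC addKr.
have [||||C C0 GC] := @open_mapping_relation _ X X G.
- by split; rewrite ?subr0 rpred0.
- move=> a m y m' y' [Mm Nm] [Mm' Nm']; split; first by rewrite rpredD// rpredZ.
  by rewrite opprD addrACA -scalerBr rpredD// rpredZ.
- move=> u v m y Guv um vy; split.
    by apply: (closed_cvg_nat cM _ um) => n; have [] := Guv n.
  apply: (closed_cvg_nat cN (u := fun n => v n - u n)); last exact: cvgB.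
  by move=> n; have [] := Guv n.
- rewrite (_ : [set y | _] = setT); first exact: closedT.
  by apply/seteqP; split=> // y _; exact: onto.
have {}GC y : exists m, G m y /\ rnorm m <= C * rnorm y.
  by have [m /GC[m' ? ?]] := onto y; exists m'.
have [P PG] := choice GC.
by exists P, C; split=> // x; have [[]] := PG x.
Qed.

End projection.

(** * From a Kato decomposition to Drazin invertibility *)

Section Kato_to_Drazin.
Context {R : realType} {X : completeNormedModType R[i]}.
Variables (T : {linear X -> X}) (cT : continuous T) (M N : submodClosed X).
Hypotheses (cM : closed [set` M]) (cN : closed [set` N]).
Hypothesis (dsum : direct_sum [set` M] [set` N]).
Hypotheses (TM : invariant_subspace T M) (TN : invariant_subspace T N).
Hypothesis (srT : semi_regular (restriction TM)).
Hypothesis (qnT : quasinilpotent (restriction TN)).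

Lemma iter_invariant (F : submodClosed X) n x :
  invariant_subspace T F -> x \in F -> iter n T x \in F.
Proof. by move=> TF Fx; elim: n => //= n; exact: TF. Qed.

Lemma quasinilpotent_decay (e : R) : 0 < e ->
  \forall n \near \oo, forall x, x \in N ->
    rnorm (iter n T x) <= e ^+ n * rnorm x.
Proof.
move=> e0; have /root_cvg0P hq := qnT.
have lN n := @iter_linear _ _ (restriction TN) n.
have cTN n := @iter_continuous _ _ (restriction TN) n
  (@restriction_continuous _ _ _ cT N TN).
apply: filterS (hq (fun n => opnorm_ge0 (lN n) (cTN n)) e e0) => n hn x Nx.
have := ler_opnorm (lN n) (cTN n) (Subsp Nx).
have -> : rnorm (iter n (restriction TN) (Subsp Nx)) = rnorm (iter n T x).
  by rewrite -(iter_restriction TN n (Subsp Nx)).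
by move=> /le_trans; apply; rewrite ler_wpM2r// rnorm_ge0.
Qed.

Lemma quasinilpotent_sub : [set` N] `<=` quasinilpotent_part T.
Proof.
move=> x /= Nx; apply/quasinilpotent_partP => e e0.
have e2 : 0 < e / 2 by rewrite divr_gt0.
have h01 := @half01 R.
apply: filterS2 (quasinilpotent_decay e2) (geometric_small (rnorm x) h01 ltr01).
move=> n /(_ x Nx) hn xn; apply: le_trans hn _.
rewrite exprMn -mulrA ler_piMr ?exprn_ge0 ?(ltW e0)//.
by rewrite mulrC ltW.
Qed.

Lemma kernel_sub_range n m : m \in M -> iter n T m = 0 ->
  exists2 m', m' \in M & T m' = m.
Proof.
move=> Mm Tm; have [|[m' Mm'] _ /(congr1 val) /= m'E] := srT.2 n (Subsp Mm).
  by apply: val_inj; rewrite (iter_restriction TM n (Subsp Mm)).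
by exists m'.
Qed.

Lemma range_closed : closed [set y | exists2 m, m \in M & T m = y].
Proof.
apply/closed_rnormP => x hx.
have Mx : x \in M.
  apply: ((closed_rnormP [set` M]).1 cM x) => e /hx[_ [m Mm <-] xm].
  by exists (T m) => //; exact: TM.
have [|[m Mm] _ /(congr1 val) /= mE] := (closed_rnormP _).1 srT.1 (Subsp Mx).
  by move=> e /hx[_ [m Mm <-] xm]; exists (restriction TM (Subsp Mm)) => //.
by exists m.
Qed.

(** T need not be injective on M, so the open mapping theorem yields a preimage
    of controlled norm rather than an inverse map. *)
Lemma range_bounded_inverse : exists2 C : R, 0 < C &
  forall m, m \in M -> exists2 m', m' \in M /\ T m' = T m &
    rnorm m' <= C * rnorm (T m).
Proof.
pose G m y := m \in M /\ T m = y.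
have [||||C C0 GC] := @open_mapping_relation _ X X G.
- by split; rewrite ?rpred0 ?linear0.
- move=> a m y m' y' [Mm <-] [Mm' <-]; split; first by rewrite rpredD// rpredZ.
  by rewrite linearP.
- move=> u v m y Guv um vy; split.
    by apply: (closed_cvg_nat cM _ um) => n; have [] := Guv n.
  apply: (norm_cvg_unique _ vy); have -> : v = T \o u.
    by apply/funext => n; have [] := Guv n.
  by apply: continuous_cvg => //; exact: cT.
- rewrite (_ : [set y | _] = [set y | exists2 m, m \in M & T m = y]).
    exact: range_closed.
  by apply/seteqP; split=> y [m]; [move=> [? ?] | move=> ? ?]; exists m.
exists C => // m Mm; have [m' [? ?] ?] := GC m (T m) (conj Mm erefl).
by exists m'.
Qed.

(** The invariant carried along the construction of the functionals phi_n:
    vanishing on ker T in M is what makes phi_(n+1) well defined on T(M), and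
    vanishing on the kernels of all powers is what makes this condition pass
    from phi_n to phi_(n+1). *)
Definition kills_kernels (phi : dual X) :=
  (forall k, k \in N -> phi k = 0) /\
  (forall m n, m \in M -> iter n T m = 0 -> phi m = 0).

(** psi extends Tm + k |-> phi(m).  A vector m of ker T^n is Tm' with m' in
    ker T^(n+1) by semi-regularity, so psi(m) = phi(m') = 0. *)
Lemma kills_kernels_lift : exists2 C : R, 0 < C &
  forall phi, kills_kernels phi -> exists psi,
    [/\ kills_kernels psi, forall x, psi (T x) = phi x &
    rnorm psi <= C * rnorm phi].
Proof.
have [P [C1 [C10 PM PN PC]]] := direct_sum_projection cM cN dsum.
have [C2 C20 TC] := range_bounded_inverse.
exists (C2 * C1); first by rewrite mulr_gt0.
move=> phi [phiN phiM].
pose G y a := exists2 m, m \in M & y - T m \in N /\ a = phi m.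
have C0 : 0 <= C2 * C1 * rnorm phi by rewrite !mulr_ge0 ?rnorm_ge0// ltW.
have [|||psi [psiG psiC]] := @hahn_banach _ X G _ C0.
- exists 0; rewrite ?rpred0// linear0 subr0 rpred0; split=> //.
  by rewrite phiN ?rpred0.
- move=> a x z y w [m Mm [xm ->]] [m' Mm' [ym' ->]].
  exists (a *: m + m'); first by rewrite rpredD// rpredZ.
  rewrite dual_linear; split=> //.
  by rewrite linearP opprD addrACA -scalerBr rpredD// rpredZ.
- move=> y _ [m Mm [ym ->]].
  have Py : P y = T m.
    by apply: (direct_sum_unique dsum (x := y)) => //; exact: TM.
  have [m' [Mm' Tm'] m'C] := TC m Mm.
  have -> : phi m = phi m'.
    apply/eqP; rewrite -subr_eq0 -dualB; apply/eqP.
    by apply: (phiM _ 1%N); [exact: submodB | rewrite /= linearB Tm' subrr].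
  apply: le_trans (dual_rnorm_apply _ _) _.
  rewrite [leRHS]mulrAC mulrC ler_wpM2r ?rnorm_ge0//.
  apply: le_trans m'C _; rewrite -mulrA ler_wpM2l ?(ltW C20)//.
  by rewrite -Py PC.
exists psi; split.
- split=> [k Nk|m n Mm Tm].
    by apply: psiG; exists 0; rewrite ?rpred0// linear0 subr0 phiN ?rpred0.
  have [m' Mm' mE] := kernel_sub_range Mm Tm.
  apply: psiG; exists m' => //; rewrite mE subrr rpred0; split=> //.
  by rewrite (phiM m' n.+1)// iterSr mE.
- move=> x; apply: psiG; exists (P x); first exact: PM.
  split; first by rewrite -linearB; exact: (TN (PN x)).
  by apply/eqP; rewrite -subr_eq0 -dualB (phiN _ (PN x)).
- by apply: dual_rnorm_le.
Qed.

(** The functional a x0 + Tm + k |-> a is bounded since x0 has positive distance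
    to the closed subspace T(M). *)
Lemma cokernel_functional x0 : x0 \in M -> (forall m, m \in M -> T m <> x0) ->
  exists phi, [/\ kills_kernels phi, forall x, phi (T x) = 0 & phi x0 = 1].
Proof.
move=> Mx0 x0n.
have [P [C1 [C10 PM PN PC]]] := direct_sum_projection cM cN dsum.
have [d d0 dP] : exists2 d : R, 0 < d &
    forall m, m \in M -> d <= rnorm (x0 - T m).
  apply: contrapT => nd.
  suff [m Mm] : [set y | exists2 m, m \in M & T m = y] x0 by exact: x0n.
  apply: ((closed_rnormP _).1 range_closed) => e e0.
  apply: contrapT => ne; apply: nd; exists e => // m Mm.
  rewrite leNgt; apply/negP => h; apply: ne; exists (T m) => //.
  by exists m.
pose G x a := exists2 m, m \in M & x - (a *: x0 + T m) \in N.
have C0 : 0 <= C1 / d by rewrite divr_ge0// ltW.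
have [|||phi [phiG _]] := @hahn_banach _ X G _ C0.
- by exists 0; rewrite ?rpred0// linear0 scale0r addr0 subr0 rpred0.
- move=> a x z y w [m Mm xm] [m' Mm' ym'].
  exists (a *: m + m'); first by rewrite rpredD// rpredZ.
  rewrite (_ : (a * z + w) *: x0 + T (a *: m + m') =
      a *: (z *: x0 + T m) + (w *: x0 + T m')); last first.
    by rewrite linearP scalerDl scalerDr scalerA addrACA.
  rewrite opprD addrACA -scalerBr.
  by rewrite rpredD// rpredZ.
- move=> x a [m Mm xm].
  have Mam : a *: x0 + T m \in M by rewrite rpredD// ?rpredZ// TM.
  have Px := direct_sum_unique dsum (PM x) Mam (PN x) xm.
  rewrite mulrAC ler_pdivlMr//; apply: le_trans (PC x); rewrite Px.
  have [->|a0] := eqVneq a 0; first by rewrite rnorm0 mul0r rnorm_ge0.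
  have -> : a *: x0 + T m = a *: (x0 - T (- a^-1 *: m)).
    rewrite scalerBr scaleNr (linearN T) (linearZZ T) scalerN opprK scalerA.
    by rewrite divff// scale1r.
  by rewrite rnormZE ler_wpM2l ?rnorm_ge0// dP// rpredZ.
have phiT x : phi (T x) = 0.
  apply: phiG; exists (P x); first exact: PM.
  rewrite scale0r add0r -linearB.
  exact: (TN (PN x)).
exists phi; split=> //; first split.
- move=> k Nk; apply: phiG; exists 0; rewrite ?rpred0//.
  by rewrite linear0 scale0r addr0 subr0.
- by move=> m n Mm /(kernel_sub_range Mm)[m' _ <-].
- apply: phiG; exists 0; rewrite ?rpred0//.
  by rewrite linear0 scale1r addr0 subrr rpred0.
Qed.

Lemma SVEP_range_full : SVEP_at (adjoint cT) 0 ->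
  forall x, x \in M -> exists2 m, m \in M & T m = x.
Proof.
move=> svep x0 Mx0; apply: contrapT => nx0.
have [|phi0 [good0 phi0T phi0x]] := @cokernel_functional x0 Mx0.
  by move=> m Mm Tm; apply: nx0; exists m.
have [C C0 lift] := kills_kernels_lift.
have /choice[next nextP] : forall phi, exists psi, kills_kernels phi ->
    [/\ kills_kernels psi, forall x, psi (T x) = phi x &
        rnorm psi <= C * rnorm phi].
  move=> phi; have [/lift[psi ?]|?] := pselect (kills_kernels phi).
    by exists psi.
  by exists phi.
pose phi n := iter n next phi0.
have good n : kills_kernels (phi n).
  by elim: n => //= n IH; have [] := nextP _ IH.
suff /(congr1 (fun psi : dual X => psi x0)) : phi 0%N = 0.
  by rewrite [LHS]phi0x => /eqP; rewrite oner_eq0.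
apply: (SVEP_backward_orbit C0 svep (phi := phi) (C := rnorm phi0)) => //.
  by move=> n x; have [] := nextP _ (good n).
elim=> [|n IH]; first by rewrite expr0 mulr1.
have [_ _ h] := nextP _ (good n); apply: le_trans h _.
by rewrite exprS mulrCA ler_wpM2l// ltW.
Qed.

(** If x = T^n (u n) with u of geometric growth, then the N-component of x is
    T^n applied to that of u n, and the decay of T^n on N beats the growth of u.
    Conversely, iterating a bounded choice of preimages in M gives backward
    orbits. *)
Lemma core_eq : SVEP_at (adjoint cT) 0 -> analytical_core T = [set` M].
Proof.
move=> /SVEP_range_full onto; apply/seteqP; split=> x.
  have [P [C1 [C10 PM PN PC]]] := direct_sum_projection cM cN dsum.
  move=> /analytical_coreP[u [C [d [d0 u0 uT ud]]]].
  have C0 : 0 <= C := geometric_bound_ge0 ud.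
  have xE n : x = iter n T (u n) by elim: n => [//|n IH]; rewrite iterSr uT.
  have PE n : x - P x = iter n T (u n - P (u n)).
    rewrite iterB -xE; congr (_ - _).
    apply: (direct_sum_unique dsum (x := x)) => //.
      exact: (iter_invariant _ TM (PM _)).
    by rewrite {1}(xE n) -iterB; exact: (iter_invariant _ TN (PN _)).
  (* chosen so that (2 d)^-n d^n = 2^-n *)
  have e0 : 0 < (2 * d)^-1 by rewrite invr_gt0 mulr_gt0.
  have h01 := @half01 R.
  suff x0 : x - P x = 0 by rewrite /= -(subrK (P x) x) x0 add0r.
  apply: rnorm_eq0; apply/eqP; rewrite eq_le rnorm_ge0 andbT.
  apply/ler_addgt0Pr => e e1; rewrite add0r.
  have [n [hn xn]] := filter_ex (filterI
    (geometric_small ((1 + C1) * C) h01 e1) (quasinilpotent_decay e0)).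
  apply: le_trans (ltW hn); rewrite (PE n); apply: le_trans (xn _ (PN _)) _.
  have un : rnorm (u n - P (u n)) <= (1 + C1) * (C * d ^+ n).
    apply: le_trans (rnormD _ _) _; rewrite rnormN.
    apply: (@le_trans _ _ ((1 + C1) * rnorm (u n))).
      by rewrite mulrDl mul1r lerD.
    by rewrite ler_wpM2l// addr_ge0// ltW.
  have en : 0 <= (2 * d)^-1 ^+ n by rewrite exprn_ge0// ltW.
  apply: le_trans (ler_wpM2l en un) _.
  apply: eq_ler.
  rewrite !exprVn exprMn; field.
  by rewrite !expf_neq0 ?gt_eqF.
move=> Mx; have [C C0 TC] := range_bounded_inverse.
have /choice[s sP] : forall y, exists z, y \in M ->
    [/\ z \in M, T z = y & rnorm z <= C * rnorm y].
  move=> y; have [My|?] := pselect (y \in M); last by exists 0.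
  have [m Mm mE] := onto y My; have [m' [Mm' Tm'] m'C] := TC m Mm.
  by exists m' => _; rewrite -mE.
have Ms n : iter n s x \in M by elim: n => //= n /sP[].
apply/analytical_coreP; exists (fun n => iter n s x), (rnorm x), C; split=> //.
  by move=> n /=; have [] := sP _ (Ms n).
elim=> [|n IH] /=; first by rewrite expr0 mulr1.
have [_ _ h] := sP _ (Ms n); apply: le_trans h _.
by rewrite exprS mulrCA ler_wpM2l// ltW.
Qed.

End Kato_to_Drazin.

Unset Implicit Arguments.

Theorem theorem3p2 (R : realType) (X : completeNormedModType R[i])
    (infX : infinite_dimensional X)
    (T : {linear X -> X}) (cT : continuous T) :
  right_generalized_Drazin_invertible T <->
  (exists M N : submodClosed X, is_GKD T M N) /\ SVEP_at (adjoint cT) 0.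
Proof.
split; first exact: right_generalized_Drazin_GKD.
move=> [[M [N [cM cN dsum [TM [TN [srT qnT]]]]]] svep].
have KM := core_eq cM cN dsum srT qnT svep.
split; first by rewrite KM.
exists N; split=> //; first by rewrite KM.
exact: (quasinilpotent_sub cT qnT).
Qed.
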